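(* The chain polynomial $p_{\mathcal{L}}(x)$ has only real roots for each of the following geometric lattices $\mathcal{L}$: (a) the subspace lattices $\mathcal{L}_n(q)$, for every positive integer $n$ and every prime power $q$; (b) the partition lattices $\Pi_n$ and $\Pi^B_n$, for every $n \ge 1$; (c) the lattices of flats of near-pencils and of uniform matroids.
   Context: For a finite poset $\mathcal{L}$, the chain polynomial is $p_{\mathcal{L}}(x) = \sum_{k \ge 0} c_k(\mathcal{L}) x^k$, where $c_k(\mathcal{L})$ is the number of $k$-element chains (totally ordered subsets) of $\mathcal{L}$ (so $c_0(\mathcal{L})=1$). $\mathcal{L}_n(q)$ is the set of all linear subspaces of an $n$-dimensional vector space over the field with $q$ elements, ordered by inclusion. $\Pi_n$ is the set of all set partitions of $[n]=\{1,\dots,n\}$, ordered by $\pi \preceq \sigma$ if every block of $\pi$ is contained in a block of $\sigma$. $\Pi^B_n$ is the set of all set partitions $\pi$ of $\{-n,-n+1,\dots,n\}$ such that (i) $B \in \pi$ implies $-B \in \pi$, and (ii) if $\{i,-i\} \subseteq B$ for some $i \in [n]$ and some block $B \in \pi$, then $0 \in B$. It is ordered in the same way: $\pi \preceq \sigma$ if every block of $\pi$ is contained in a block of $\sigma$. The lattice of flats of a matroid is the set of its flats ordered by inclusion. The uniform matroid of rank $n$ on $m$ elements ($m \ge n \ge 1$) has as bases all $n$-element subsets of its ground set. The near-pencil of rank $n$ on $m$ elements ($m \ge n \ge 2$) is the matroid obtained from the rank two uniform matroid on $m-n+2$ elements by adding $n-2$ coloops. *)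

(* Defs.v *)
From HB Require Import structures.
From mathcomp Require Import all_boot all_order all_algebra.
From mathcomp Require Import reals complex.

Set Implicit Arguments.
Unset Strict Implicit.
Unset Printing Implicit Defensive.
Import Order.TTheory GRing.Theory Num.Theory.
Local Open Scope ring_scope.

Definition is_chain d (L : finPOrderType d) (C : {set L}) : bool :=
  [forall x in C, forall y in C, (x >=< y)%O].

Definition nb_chains d (L : finPOrderType d) (k : nat) : nat :=
  #|[set C : {set L} | is_chain C & #|C| == k]|.

(* A chain of L has at most #|L| elements, so truncating at #|L|.+1 loses
   nothing. *)
Definition chain_poly d (L : finPOrderType d) : {poly int} :=
  \poly_(k < #|L|.+1) (nb_chains L k)%:Z.

Definition real_rooted (R : realType) (p : {poly int}) : Prop :=
  forall z : R[i], root (map_poly intr p) z -> complex.Im z = 0.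

Fact inclusion_display : Order.disp_t. Proof. exact: Order.Disp tt tt. Qed.

(* An alias of {vspace V}, which carries no order in the library. *)
Definition subspaces (F : finFieldType) (V : vectType F) : Type := {vspace V}.

Section Subspaces.
Variables (F : finFieldType) (V : vectType F).

HB.instance Definition _ :=
  [isSub of subspaces V for (@VectorInternalTheory.vs2mx F V)].
HB.instance Definition _ := [Finite of subspaces V by <:].

Definition subspaces_le (U W : subspaces V) : bool := (U <= W)%VS.

Fact subspaces_le_refl : reflexive subspaces_le.
Proof. by move=> U; exact: subvv. Qed.

Fact subspaces_le_anti : antisymmetric subspaces_le.
Proof. exact: subv_anti. Qed.

Fact subspaces_le_trans : transitive subspaces_le.
Proof. by move=> U W X; exact: subv_trans. Qed.

HB.instance Definition _ := Order.Le_isPOrder.Build inclusion_display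
  (subspaces V) subspaces_le_refl subspaces_le_anti subspaces_le_trans.

End Subspaces.

Fact refinement_display : Order.disp_t. Proof. exact: Order.Disp tt tt. Qed.

Record setpart (T : finType) := Setpart {
  blocks :> {set {set T}};
  setpartP : partition blocks [set: T]
}.

Section SetPartitions.
Variable T : finType.

HB.instance Definition _ := [isSub for @blocks T].
HB.instance Definition _ := [Finite of setpart T by <:].

Definition refines (P Q : setpart T) : bool :=
  [forall B in blocks P, exists C in blocks Q, B \subset C].

Fact refinesP (P Q : setpart T) :
  reflect (forall B, B \in blocks P -> exists2 C, C \in blocks Q & B \subset C)
          (refines P Q).
Proof.
apply: (iffP forall_inP) => h B /h; first by case/exists_inP=> C; exists C.
by case=> C QC sBC; apply/exists_inP; exists C.
Qed.

Fact refines_refl : reflexive refines.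
Proof. by move=> P; apply/refinesP => B PB; exists B. Qed.

Fact refines_trans : transitive refines.
Proof.
move=> Q P S /refinesP sPQ /refinesP sQS; apply/refinesP => B /sPQ[C /sQS[D]].
by move=> SD sCD sBC; exists D => //; apply: subset_trans sCD.
Qed.

Fact refines_anti : antisymmetric refines.
Proof.
suff sub (P Q : setpart T) : refines P Q -> refines Q P ->
    blocks P \subset blocks Q.
  move=> P Q /andP[sPQ sQP]; apply: val_inj; apply/eqP.
  by rewrite eqEsubset !sub.
move=> /refinesP sPQ /refinesP sQP; apply/subsetP => B PB.
have [C QC sBC] := sPQ _ PB; have [D PD sCD] := sQP _ QC.
have /and3P[_ tP nP] := setpartP P.
have /set0Pn[x Bx] : B != set0 by apply: contraNneq nP => <-.
have eBD : B = D.
  by rewrite -(def_pblock tP PB Bx) (def_pblock tP PD) ?(subsetP sCD) ?(subsetP sBC).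
suff -> : B = C by [].
by apply/eqP; rewrite eqEsubset sBC eBD sCD.
Qed.

HB.instance Definition _ := Order.Le_isPOrder.Build refinement_display
  (setpart T) refines_refl refines_anti refines_trans.

End SetPartitions.

(* 'I_n is {0, ..., n-1} rather than {1, ..., n}. *)
Definition Pi (n : nat) : Type := setpart 'I_n.
HB.instance Definition _ n := Order.FinPOrder.on (Pi n).

(* The set {-n, ..., n}: the ordinal i stands for the integer i - n. *)
Definition signed (n : nat) : Type := 'I_n.*2.+1.
HB.instance Definition _ n := Finite.on (signed n).

Definition signed_val n (i : signed n) : int := (i : nat)%:Z - n%:Z.
Definition signed0 n : signed n := inord n.
Definition signed_opp n (i : signed n) : signed n := rev_ord i.

Fact signed_val_inj n : injective (@signed_val n).
Proof. by move=> i j /addIr[]; exact: val_inj. Qed.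

Fact signed_val_norm n (i : signed n) : `|signed_val i| <= n%:Z.
Proof.
rewrite ler_norml /signed_val lerBrDr addNr lerBlDr -PoszD lez_nat addnn.
exact: leq_ord i.
Qed.

Fact signed_val0 n : signed_val (signed0 n) = 0.
Proof. by rewrite /signed_val inordK ?subrr // ltnS -addnn leq_addr. Qed.

Fact signed_val_opp n (i : signed n) :
  signed_val (signed_opp i) = - signed_val i.
Proof.
rewrite /signed_val /signed_opp /= subSS opprB -subzn; last first.
  exact: leq_ord i.
have -> : n.*2%:Z = n%:Z + n%:Z by rewrite -addnn.
by rewrite addrAC addrK.
Qed.

Definition typeB n (P : setpart (signed n)) : bool :=
  [forall B in blocks P, (@signed_opp n @: B) \in blocks P] &&
  [forall B in blocks P, forall i : signed n,
     (0 < signed_val i) && (i \in B) && (signed_opp i \in B)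
       ==> (signed0 n \in B)].

Record PiB (n : nat) := MkPiB {
  PiB_part :> setpart (signed n);
  PiB_typeB : typeB PiB_part
}.

HB.instance Definition _ n := [isSub for @PiB_part n].
HB.instance Definition _ n := [Finite of PiB n by <:].
HB.instance Definition _ n :=
  [SubChoice_isSubPOrder of PiB n by <: with refinement_display].

Record matroid (E : finType) := Matroid {
  bases : {set {set E}};
  bases_neq0 : bases != set0;
  bases_exchange : forall B1 B2 x, B1 \in bases -> B2 \in bases ->
    x \in B1 :\: B2 -> exists2 y, y \in B2 :\: B1 & y |: (B1 :\ x) \in bases
}.

Section Flats.
Variables (E : finType) (M : matroid E).

Definition rank (A : {set E}) : nat := (\max_(B in bases M) #|A :&: B|)%N.

Definition is_flat (A : {set E}) : bool :=
  [forall x, (x \notin A) ==> (rank A < rank (x |: A))%N].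

Record flats := Flat { flat_set :> {set E}; flatP : is_flat flat_set }.

HB.instance Definition _ := [isSub for flat_set].
HB.instance Definition _ := [Finite of flats by <:].

Definition flats_le (A B : flats) : bool := flat_set A \subset flat_set B.

Fact flats_le_refl : reflexive flats_le.
Proof. by move=> A; exact: subxx. Qed.

Fact flats_le_anti : antisymmetric flats_le.
Proof. by move=> A B sAB; apply/val_inj/eqP; rewrite eqEsubset. Qed.

Fact flats_le_trans : transitive flats_le.
Proof. by move=> B A C; exact: subset_trans. Qed.

HB.instance Definition _ := Order.Le_isPOrder.Build inclusion_display
  flats flats_le_refl flats_le_anti flats_le_trans.

End Flats.

Section Uniform.
Variables (n m : nat) (le_nm : (n <= m)%N).

Definition uniform_bases : {set {set 'I_m}} := [set B : {set 'I_m} | #|B| == n].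

Fact uniform_bases_neq0 : uniform_bases != set0.
Proof. by rewrite -card_gt0 card_draws card_ord bin_gt0. Qed.

Fact uniform_bases_exchange B1 B2 x :
  B1 \in uniform_bases -> B2 \in uniform_bases -> x \in B1 :\: B2 ->
  exists2 y, y \in B2 :\: B1 & y |: (B1 :\ x) \in uniform_bases.
Proof.
rewrite !inE => /eqP cB1 /eqP cB2 /andP[B2'x B1x].
have [y B21y] : exists y, y \in B2 :\: B1.
  apply/set0Pn; rewrite -card_gt0 -(ltn_add2l #|B2 :&: B1|) addn0 cardsID.
  rewrite cB2 -cB1 -(cardsID B2 B1) setIC -[ltnLHS]addn0 ltn_add2l card_gt0.
  by apply/set0Pn; exists x; rewrite inE B2'x.
exists y => //; move: B21y; rewrite !inE => /andP[B1'y _].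
by rewrite cardsU1 !inE negb_and B1'y orbT -cB1 [in eqbRHS](cardsD1 x) B1x.
Qed.

Definition uniform_matroid : matroid 'I_m :=
  Matroid uniform_bases_neq0 uniform_bases_exchange.

End Uniform.

Section Coloops.
Variables (E : finType) (M : matroid E) (k : nat).

Definition coloop_ext (B : {set E}) : {set E + 'I_k} :=
  [set u | if u is inl x then x \in B else true].

Definition coloop_bases : {set {set E + 'I_k}} := coloop_ext @: bases M.

Fact coloop_bases_neq0 : coloop_bases != set0.
Proof. by rewrite imset_eq0 bases_neq0. Qed.

Fact coloop_bases_exchange B1 B2 u :
  B1 \in coloop_bases -> B2 \in coloop_bases -> u \in B1 :\: B2 ->
  exists2 v, v \in B2 :\: B1 & v |: (B1 :\ u) \in coloop_bases.
Proof.
case/imsetP=> A1 MA1 ->{B1} /imsetP[A2 MA2 ->{B2}].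
case: u => [x|i]; last by rewrite !inE.
rewrite !inE => A12x.
have [|y A21y MA] := bases_exchange MA1 MA2 (x := x); first by rewrite inE.
exists (inl y); first by move: A21y; rewrite !inE.
apply/imsetP; exists (y |: (A1 :\ x)) => //.
by apply/setP=> -[z|i]; rewrite !inE ?orbT.
Qed.

Definition add_coloops : matroid (E + 'I_k)%type :=
  Matroid coloop_bases_neq0 coloop_bases_exchange.

End Coloops.

(* The truncated subtractions are exact when 2 <= n <= m, the only range in
   which this is the near-pencil of rank n on m elements. *)
Definition near_pencil (n m : nat) : matroid ('I_(m - n + 2) + 'I_(n - 2))%type :=
  add_coloops (uniform_matroid (leq_addl (m - n) 2)) (n - 2).

(* Main.v *)
(* For z in the open upper half-plane and a sequence lam of positive integers,
   build rows of complex numbers V(0), V(1), ... by V(0) = (1) and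
     V(n+1)_k = z sum_{j < k} lam_j V(n)_j + (1 + z) sum_{j >= k} lam_j V(n)_j.
   This preserves the property that the entries of a row turn monotonically
   within the cone spanned by V(n)_0 and z / (1 + z) V(n)_0 (the pointwise form
   of an interlacing sequence of polynomials), so no nontrivial nonnegative
   combination of a row vanishes at z.
   Put p_n = V(n)_n and let h be the complete homogeneous polynomials.  Then
   V(n)_k = sum_j h_{n-j}(lam_k, ..., lam_j) p_j, which forces
   p_n = z sum_{j < n} h_{n-j}(lam_0, ..., lam_j) p_j for n > 0: this is the
   recursion satisfied by the chain polynomials of a poset in which an element
   of rank n has h_{n-j}(lam_0, ..., lam_j) elements of rank j below it, and the
   whole chain polynomial at z is (1 + z) V(n)_0.
   Subspace lattices are of this kind with lam_j = q^j.  The duals of Pi_n and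
   Pi^B_n are too, with lam_j = j + 1 and lam_j = 2 j + 1: classifying the (odd)
   maps constant on the blocks of a partition by their kernel gives
   lam_m^n = sum_Q prod_{i < rank Q} (lam_m - lam_i) for all m, and Newton
   interpolation then determines the number of Q of each rank.  For uniform
   matroids and near-pencils (lam = 1) the chain polynomial is (1 + z)^2,
   resp. 1 + z, times a nonnegative combination of a row. *)

Require Import Defs.
From HB Require Import structures.
From mathcomp Require Import all_boot all_order all_algebra all_field reals complex.
From mathcomp Require Import ring lra zify.

Set Implicit Arguments.
Unset Strict Implicit.
Unset Printing Implicit Defensive.
Import Order.TTheory GRing.Theory Num.Theory.
Local Open Scope ring_scope.

(** * Newton interpolation *)

Section Weights.
Variable lam : nat -> nat.

(* The complete homogeneous symmetric polynomial of degree [m + k - j] in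
   [lam k, ..., lam j]. *)
Fixpoint weights (m k j : nat) : nat :=
  if m is m'.+1 then (weights m' k.+1 j + lam k * weights m' k j)%N
  else (k == j)%N.

Lemma weights0 k j : weights 0 k j = (k == j). Proof. by []. Qed.

Lemma weightsS m k j :
  weights m.+1 k j = (weights m k.+1 j + lam k * weights m k j)%N.
Proof. by []. Qed.

Lemma weightsS0 m k : weights m.+1 k 0 = (lam 0 * weights m k 0)%N.
Proof.
elim: m k => [|m IHm] k; first by case: k => [|k] //=; rewrite !muln0.
rewrite weightsS [weights m.+1 k.+1 0]IHm [in LHS]IHm [in RHS]weightsS.
by rewrite mulnDr; ring.
Qed.

(** The definition splits off the first variable [lam k]; this recursion splits off the last one,
    [lam j.+1], as multiplication in the Newton basis requires. *)
Lemma weightsSS m k j :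
  weights m.+1 k j.+1 = (weights m k j + lam j.+1 * weights m k j.+1)%N.
Proof.
elim: m k => [|m IHm] k.
  by rewrite /= eqSS; congr addn; case: eqP => [->|] //; rewrite !muln0.
rewrite weightsS [weights m.+1 k.+1 _]IHm [in LHS]IHm ![in RHS]weightsS.
by rewrite !mulnDr; ring.
Qed.

Lemma weights_small m k j : (m + k < j)%N -> weights m k j = 0%N.
Proof.
elim: m k => [|m IHm] k ltj /=; first by case: eqP => // kj; lia.
by rewrite !IHm ?muln0 //; lia.
Qed.

Lemma weights_diag m k : weights m k (m + k) = 1%N.
Proof.
elim: m k => [|m IHm] k /=; first by rewrite eqxx.
by rewrite addSnnS IHm weights_small ?muln0 // addnS.
Qed.

End Weights.

Arguments weights : simpl never.

Section Newton.
Variable lam : nat -> nat.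
Hypothesis lam_inc : forall i j, (i < j)%N -> (lam i < lam j)%N.

(* The truncated subtractions are harmless: if [m < k], the factor [i = m]
   already vanishes. *)
Definition newton k m := (\prod_(i < k) (lam m - lam i))%N.

Lemma newton_eq0 k m : (m < k)%N -> newton k m = 0%N.
Proof.
by move=> ltmk; rewrite /newton (bigD1 (Ordinal ltmk)) //= subnn mul0n.
Qed.

Lemma newton_gt0 k m : (k <= m)%N -> (0 < newton k m)%N.
Proof.
move=> lekm; apply: prodn_gt0 => i; rewrite subn_gt0 lam_inc //.
exact: leq_trans (ltn_ord i) lekm.
Qed.

(** Multiplication by the variable in the Newton basis. Under truncated subtraction it persists for
    [m < k], where every term vanishes. *)
Lemma newtonS k m : (lam m * newton k m = newton k.+1 m + lam k * newton k m)%N.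
Proof.
rewrite {2}/newton big_ord_recr /= -/(newton k m).
case: (ltngtP k m) => [ltkm|ltmk|->]; last by rewrite subnn muln0.
  by rewrite [X in (X + _)%N]mulnC -mulnDl subnK // ltnW ?lam_inc.
by rewrite newton_eq0 // !muln0.
Qed.

(* Newton interpolation of the monomial [X ^ n] at the nodes [lam i]. *)
Lemma newton_expn n m :
  (lam m ^ n = \sum_(k < n.+1) weights lam n 0 k * newton k m)%N.
Proof.
elim: n => [|n IHn]; first by rewrite big_ord1 /newton big_ord0.
rewrite expnS IHn big_distrr /=.
under eq_bigr => k _ do rewrite mulnCA newtonS mulnDr.
rewrite big_split /= [RHS]big_ord_recl
  -[weights _ _ _ ord0]/(weights lam n.+1 0 0) weightsS0.
under [in RHS]eq_bigr => k _ do rewrite lift0 weightsSS mulnDl.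
rewrite big_split /= addnCA; congr addn.
rewrite [LHS]big_ord_recl [in RHS]big_ord_recr /=.
rewrite [weights _ _ _ n.+1]weights_small ?addn0 // muln0 mul0n addn0.
by congr addn; [ring | apply: eq_bigr => k _; rewrite /bump; ring].
Qed.

Lemma sum_ord_trunc (f : nat -> nat) a b : (a <= b)%N ->
  (forall j, (a <= j)%N -> f j = 0%N) -> (\sum_(j < b) f j = \sum_(j < a) f j)%N.
Proof.
move=> leab f0; rewrite -!(big_mkord xpredT) (big_cat_nat (n := a)) //=.
by rewrite [X in (_ + X)%N = _]big_nat [X in (_ + X)%N]big1 ?addn0 // => j /andP[/f0].
Qed.

(** Cutting the sum at the node instead of the degree makes the equations for the coefficients
    triangular. *)
Lemma newton_expn_trunc n k :
  (lam k ^ n = \sum_(j < k.+1) weights lam n 0 j * newton j k)%N.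
Proof.
rewrite newton_expn; have [lekn|ltnk] := leqP k n.
  by apply: (@sum_ord_trunc (fun j => weights _ n 0 j * newton j k)%N) => // j ltkj;
     rewrite newton_eq0 ?muln0.
apply/esym/(@sum_ord_trunc (fun j => weights _ n 0 j * newton j k)%N) => [|j ltnj].
  exact: leqW.
by rewrite weights_small ?addn0.
Qed.

(* The expansion in the Newton basis is unique, and it can be read off from the
   values at the nodes. *)
Lemma newton_count (I : finType) (A : pred I) (r : I -> nat) n :
  (forall m, lam m ^ n = \sum_(i | A i) newton (r i) m)%N ->
  forall k, #|[set i | A i & r i == k]| = weights lam n 0 k.
Proof.
move=> NE; pose N k := #|[set i | A i & r i == k]|.
have NE' m : (lam m ^ n = \sum_(j < m.+1) N j * newton j m)%N.
  rewrite NE (bigID (fun i => (r i < m.+1)%N)) /= [X in (_ + X)%N]big1.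
    rewrite addn0 (partition_big (fun i => inord (r i) : 'I_m.+1) xpredT) //=.
    apply: eq_bigr => j _; rewrite /N -sum1dep_card big_distrl /=.
    apply: eq_big => [i|i /andP[/andP[_ ltim] /eqP<-]].
      rewrite -andbA; congr (_ && _); apply/andP/eqP => [[ltim /eqP<-]|->].
        by rewrite inordK.
      by rewrite inord_val ltn_ord.
    by rewrite inordK // mul1n.
  by move=> i /andP[_]; rewrite -leqNgt => /newton_eq0.
(* At the node [k] only the coefficient of [newton k] is still unknown, and its factor [newton k k]
   is positive. *)
elim/ltn_ind => k IHk; have := NE' k; rewrite newton_expn_trunc !big_ord_recr /=.
under [in RHS]eq_bigr => j _ do rewrite [N j]IHk //.
by move/addnI/eqP; rewrite eqn_pmul2r ?newton_gt0 // => /eqP.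
Qed.

End Newton.

(** * Rows of complex numbers turning monotonically *)

Section Cross.
Variable R : rcfType.
Local Notation C := R[i].
Implicit Types (u v w z : C).

(** This is [Im (conj u * v)]: for nonzero arguments, nonnegative when [v] is reached from [u] by a
    counterclockwise turn of at most a half circle. *)
Definition cross u v : R := complex.Re u * complex.Im v - complex.Im u * complex.Re v.

Lemma crossDl u1 u2 v : cross (u1 + u2) v = cross u1 v + cross u2 v.
Proof. by case: u1 u2 v => [a b] [c d] [e f]; rewrite /cross /=; ring. Qed.

Lemma crossDr u v1 v2 : cross u (v1 + v2) = cross u v1 + cross u v2.
Proof. by case: v1 v2 u => [a b] [c d] [e f]; rewrite /cross /=; ring. Qed.

Lemma cross0l v : cross 0 v = 0. Proof. by rewrite /cross /=; ring. Qed.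
Lemma cross0r v : cross v 0 = 0. Proof. by rewrite /cross /=; ring. Qed.

Lemma crossZl (c : R) u v : cross (c%:C%C * u) v = c * cross u v.
Proof. by case: u v => [a b] [d e]; rewrite /cross /=; ring. Qed.

Lemma crossZr (c : R) u v : cross u (c%:C%C * v) = c * cross u v.
Proof. by case: u v => [a b] [d e]; rewrite /cross /=; ring. Qed.

Definition sqnorm u : R := complex.Re u ^+ 2 + complex.Im u ^+ 2.

Lemma sqnorm_ge0 u : 0 <= sqnorm u.
Proof. by rewrite addr_ge0 ?sqr_ge0. Qed.

Lemma sqnorm_gt0 u : u != 0 -> 0 < sqnorm u.
Proof.
move=> u0; rewrite lt_neqAle sqnorm_ge0 andbT eq_sym paddr_eq0 ?sqr_ge0 //.
by move: u0; rewrite !sqrf_eq0 eq_complex /=.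
Qed.

Variable z : C.
Hypothesis z_up : 0 < complex.Im z.

(* Up to the positive factor [sqnorm (1 + z)], [twist u v] is the cross product
   of [u] with [z / (1 + z) * v]. *)
Definition twist u v : R := cross ((1 + z) * u) (z * v).

Lemma twistDl u1 u2 v : twist (u1 + u2) v = twist u1 v + twist u2 v.
Proof. by rewrite /twist mulrDr crossDl. Qed.

Lemma twistDr u v1 v2 : twist u (v1 + v2) = twist u v1 + twist u v2.
Proof. by rewrite /twist mulrDr crossDr. Qed.

Lemma twist0l v : twist 0 v = 0. Proof. by rewrite /twist mulr0 cross0l. Qed.
Lemma twist0r v : twist v 0 = 0. Proof. by rewrite /twist mulr0 cross0r. Qed.

Lemma twistZl (c : R) u v : twist (c%:C%C * u) v = c * twist u v.
Proof. by rewrite /twist mulrCA crossZl. Qed.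

Lemma twistZr (c : R) u v : twist u (c%:C%C * v) = c * twist u v.
Proof. by rewrite /twist [z * _]mulrCA crossZr. Qed.

(** Multiplying by [z / (1 + z)] turns [u] counterclockwise when [z] is in the upper half-plane; the
    strict inequalities for fans come from this. *)
Lemma twist_self u : twist u u = complex.Im z * sqnorm u.
Proof.
by rewrite /twist; case: u z => [a b] [d e]; rewrite /cross /sqnorm /=; ring.
Qed.

(** Here [u], [v], [w] stand for the weighted sums of a row over the indices before [i], from [i] to
    [j], and from [j] on; the arguments are then the entries [i] and [j] of the next row. The two
    products of [u] with [w] cancel by antisymmetry. *)
Lemma cross_window u v w :
  cross (z * u + (1 + z) * (v + w)) (z * (u + v) + (1 + z) * w) =
  sqnorm z * cross u v + twist v u + complex.Im z * sqnorm v +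
  sqnorm (1 + z) * cross v w + twist w v.
Proof.
rewrite /twist; case: u v w z => [a b] [d e] [f g] [x y].
by rewrite /cross /sqnorm /=; ring.
Qed.

(** Both entries share the part [z * u + (1 + z) * w], which contributes its square norm, while the
    two multiples of [v] have no twist with each other. *)
Lemma twist_window u v w :
  twist (z * (u + v) + (1 + z) * w) (z * u + (1 + z) * (v + w)) =
  complex.Im z * sqnorm (z * u + (1 + z) * w) +
  sqnorm z * sqnorm (1 + z) * (cross u v + cross v w) +
  sqnorm z * twist v u + sqnorm (1 + z) * twist w v.
Proof.
rewrite /twist; case: u v w z => [a b] [d e] [f g] [x y].
by rewrite /cross /sqnorm /=; ring.
Qed.

(** The entries turn counterclockwise and none passes [z / (1 + z)] times an earlier one. All pairs
    are compared because nonnegativity of [cross] is not transitive. *)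
Definition fan (n : nat) (v : nat -> C) : Prop :=
  [/\ forall i, (i <= n)%N -> v i != 0,
      forall i j, (i <= j <= n)%N -> 0 <= cross (v i) (v j)
    & forall i j, (i <= j <= n)%N -> 0 <= twist (v j) (v i)].

Lemma big_cross_ge0 (f : C -> C -> R) (v : nat -> C) (a b : nat -> R) m1 n1 m2 n2 :
  (forall u1 u2 w, f (u1 + u2) w = f u1 w + f u2 w) ->
  (forall u w1 w2, f u (w1 + w2) = f u w1 + f u w2) ->
  (forall u, f 0 u = 0) -> (forall u, f u 0 = 0) ->
  (forall c u w, f (c%:C%C * u) w = c * f u w) ->
  (forall c u w, f u (c%:C%C * w) = c * f u w) ->
  (forall i, 0 <= a i) -> (forall i, 0 <= b i) ->
  (forall i j, (m1 <= i < n1)%N -> (m2 <= j < n2)%N -> 0 <= f (v i) (v j)) ->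
  0 <= f (\sum_(m1 <= i < n1) (a i)%:C%C * v i)
         (\sum_(m2 <= j < n2) (b j)%:C%C * v j).
Proof.
move=> fDl fDr f0l f0r fZl fZr a0 b0 fv.
rewrite (big_morph (f^~ _) (fun u1 u2 => fDl u1 u2 _) (f0l _)) big_nat.
apply: sumr_ge0 => i lti; rewrite fZl mulr_ge0 //.
rewrite (big_morph (f _) (fDr _) (f0r _)) big_nat.
by apply: sumr_ge0 => j ltj; rewrite fZr mulr_ge0 // fv.
Qed.

Lemma cross_sum_ge0 (v : nat -> C) (a b : nat -> R) m1 n1 m2 n2 :
  (forall i, 0 <= a i) -> (forall i, 0 <= b i) ->
  (forall i j, (m1 <= i < n1)%N -> (m2 <= j < n2)%N -> 0 <= cross (v i) (v j)) ->
  0 <= cross (\sum_(m1 <= i < n1) (a i)%:C%C * v i)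
             (\sum_(m2 <= j < n2) (b j)%:C%C * v j).
Proof.
apply: big_cross_ge0 => *;
by rewrite ?(crossDl, crossDr, cross0l, cross0r, crossZl, crossZr).
Qed.

Lemma twist_sum_ge0 (v : nat -> C) (a b : nat -> R) m1 n1 m2 n2 :
  (forall i, 0 <= a i) -> (forall i, 0 <= b i) ->
  (forall i j, (m1 <= i < n1)%N -> (m2 <= j < n2)%N -> 0 <= twist (v i) (v j)) ->
  0 <= twist (\sum_(m1 <= i < n1) (a i)%:C%C * v i)
             (\sum_(m2 <= j < n2) (b j)%:C%C * v j).
Proof.
apply: big_cross_ge0 => *;
by rewrite ?(twistDl, twistDr, twist0l, twist0r, twistZl, twistZr).
Qed.

Lemma fan_comb_neq0 n (v : nat -> C) (c : nat -> R) i j :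
  fan n v -> (forall k, 0 <= c k) -> 0 < c i -> (i < j <= n.+1)%N ->
  \sum_(i <= k < j) (c k)%:C%C * v k != 0.
Proof.
case=> v0 cr tw c0 ci /andP[ltij lejn].
(* The functional [cross (v i) + twist ^~ (v i)] is positive on [v i] and
   nonnegative on its successors. *)
pose f u := cross (v i) u + twist u (v i).
suff: 0 < f (\sum_(i <= k < j) (c k)%:C%C * v k).
  by apply: contraTneq => ->; rewrite /f cross0r twist0l addr0 ltxx.
have fD u w : f (u + w) = f u + f w by rewrite /f crossDr twistDl addrACA.
have f0 : f 0 = 0 by rewrite /f cross0r twist0l addr0.
have fZ a u : f (a%:C%C * u) = a * f u by rewrite /f crossZr twistZl -mulrDr.
rewrite (big_morph f fD f0) big_ltn //.
apply: ltr_wpDr.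
  rewrite big_nat; apply: sumr_ge0 => k ltk; rewrite fZ mulr_ge0 //.
  by rewrite /f addr_ge0 ?cr ?tw //; lia.
rewrite fZ; apply: mulr_gt0 => //; apply: ltr_wpDl; first by apply: cr; lia.
by rewrite twist_self mulr_gt0 // sqnorm_gt0 // v0 //; lia.
Qed.

Variable lam : nat -> nat.
Hypothesis lam_gt0 : forall k, (0 < lam k)%N.

Definition next_row n (v : nat -> C) k : C :=
  z * (\sum_(0 <= j < k) (lam j)%:R * v j) +
  (1 + z) * (\sum_(k <= j < n.+1) (lam j)%:R * v j).

Lemma fan_next n (v : nat -> C) : fan n v -> fan n.+1 (next_row n v).
Proof.
move=> fv; case: (fv) => v0 cr tw.
pose W a b := \sum_(a <= j < b) (lam j)%:R * v j.
have WE a b : W a b = \sum_(a <= j < b) ((lam j)%:R : R)%:C%C * v j.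
  by apply: eq_bigr => j _; rewrite rmorph_nat.
have W_cross a b c d : (b <= c)%N -> (d <= n.+1)%N -> 0 <= cross (W a b) (W c d).
  move=> bc dn; rewrite !WE; apply: cross_sum_ge0 => // i j *.
  by apply: cr; lia.
have W_twist a b c d : (d <= a)%N -> (b <= n.+1)%N -> 0 <= twist (W a b) (W c d).
  move=> bc dn; rewrite !WE; apply: twist_sum_ge0 => // i j *.
  by apply: tw; lia.
have nextE i j : (i <= j <= n.+1)%N ->
    next_row n v i = z * W 0%N i + (1 + z) * (W i j + W j n.+1) /\
    next_row n v j = z * (W 0%N i + W i j) + (1 + z) * W j n.+1.
  move=> /andP[ij jn]; rewrite /next_row -!/(W _ _); split; congr (_ * _ + _ * _).
    exact: big_cat_nat.
  exact: big_cat_nat.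
have n0 := sqnorm_ge0 z; have n1 := sqnorm_ge0 (1 + z).
have crE i j : (i < j <= n.+1)%N -> 0 < cross (next_row n v i) (next_row n v j).
  move=> /andP[ij jn]; have [|-> ->] := nextE i j; first by rewrite ltnW.
  have W0 : W i j != 0.
    rewrite WE; apply: (fan_comb_neq0 fv) => // [|]; last by rewrite ij.
    by rewrite ltr0n.
  rewrite cross_window; have := sqnorm_gt0 W0 => /(mulr_gt0 z_up) pos.
  have h1 := mulr_ge0 n0 (W_cross 0%N i i j (leqnn _) jn).
  have h2 := mulr_ge0 n1 (W_cross i j j n.+1 (leqnn _) (leqnn _)).
  have h3 := W_twist i j 0%N i (leqnn _) jn.
  have h4 := W_twist j n.+1 i j (leqnn _) (leqnn _).
  lra.
split.
(* A positive cross product with another entry excludes 0: entry 0 is paired with entry 1, every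
   other entry with entry 0. *)
- move=> i lei; have [i0|i0] := posnP i.
    have := crE 0%N 1%N isT; rewrite -i0; apply: contraTneq => ->.
    by rewrite cross0l ltxx.
  have /crE : (0 < i <= n.+1)%N by rewrite i0.
  by apply: contraTneq => ->; rewrite cross0r ltxx.
- move=> i j /andP[]; rewrite leq_eqVlt => /predU1P[-> _|ij jn].
    by rewrite /cross mulrC subrr.
  by rewrite ltW // crE // ij.
- move=> i j /andP[ij jn]; have [|-> ->] := nextE i j; first by rewrite ij.
  rewrite twist_window.
  have h1 := mulr_ge0 (mulr_ge0 n0 n1) (W_cross 0%N i i j (leqnn _) jn).
  have h2 := mulr_ge0 (mulr_ge0 n0 n1) (W_cross i j j n.+1 (leqnn _) (leqnn _)).
  have h3 := mulr_ge0 n0 (W_twist i j 0%N i (leqnn _) jn).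
  have h4 := mulr_ge0 n1 (W_twist j n.+1 i j (leqnn _) (leqnn _)).
  have h5 := mulr_ge0 (ltW z_up) (sqnorm_ge0 (z * W 0%N i + (1 + z) * W j n.+1)).
  lra.
Qed.

(* [tri n k] is V(n)_k and [diag n] is p_n in the notation of the header. *)
Fixpoint tri n : nat -> C :=
  if n is m.+1 then next_row m (tri m) else fun=> 1.

Lemma tri_fan n : fan n (tri n).
Proof.
elim: n => [|n /fan_next //]; split=> [i _|i j _|i j _] /=.
- exact: oner_neq0.
- by rewrite /cross mulrC subrr.
- by rewrite twist_self mulr_ge0 ?sqnorm_ge0 // ltW.
Qed.

Lemma tri_comb_neq0 n (c : nat -> R) :
  (forall k, 0 <= c k) -> 0 < c 0%N ->
  \sum_(0 <= k < n.+1) (c k)%:C%C * tri n k != 0.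
Proof. by move=> c0 c1; apply: (fan_comb_neq0 (tri_fan n)); rewrite ?leqnn. Qed.

(** Passing from entry [k.+1] to entry [k], the [k]-th term changes its coefficient from [z] to
    [1 + z]. *)
Lemma tri_step n k : (k <= n)%N ->
  tri n.+1 k = tri n.+1 k.+1 + (lam k)%:R * tri n k.
Proof.
move=> kn; rewrite [tri n.+1]/= /next_row [in RHS]big_nat_recr //=.
by rewrite (big_ltn (m := k)) //; ring.
Qed.

(** The first entry is [1 + z] times, and the last [z] times, one and the same full weighted sum. *)
Lemma tri_wrap n : z * tri n.+1 0%N = (1 + z) * tri n.+1 n.+1.
Proof.
by rewrite [tri n.+1]/= /next_row big_geq // [in RHS](big_geq (m := n.+1)) //; ring.
Qed.

Definition diag n : C := tri n n.

(** By [tri_step] the entries obey the recursion that defines [weights], with [diag] as initial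
    values. *)
Lemma tri_weights m k :
  tri (m + k) k = \sum_(j < (m + k).+1) (weights lam m k j)%:R * diag j.
Proof.
elim: m k => [|m IHm] k.
  rewrite add0n (bigD1 ord_max) //= weights0 eqxx mul1r big1 ?addr0 // => j.
  by rewrite weights0 -val_eqE /= eq_sym => /negPf->; rewrite mul0r.
rewrite addSn tri_step ?leq_addl // -addnS !IHm addnS.
under [RHS]eq_bigr => j _ do rewrite weightsS natrD mulrDl.
rewrite big_split /=; congr (_ + _).
rewrite [RHS]big_ord_recr /= weights_small ?muln0 // mul0r addr0 big_distrr /=.
by apply: eq_bigr => j _; rewrite natrM mulrA.
Qed.

Lemma tri_sum n : tri n 0 = \sum_(j < n.+1) (weights lam n 0 j)%:R * diag j.
Proof. by rewrite -{1}(addn0 n) tri_weights addn0. Qed.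

(** In [tri_wrap] the full sum contains [diag n.+1] with weight one; its contribution cancels
    against part of the right-hand side. *)
Lemma diag_rec n :
  diag n.+1 = z * \sum_(j < n.+1) (weights lam n.+1 0 j)%:R * diag j.
Proof.
have := tri_wrap n; rewrite -/(diag n.+1) tri_sum big_ord_recr.
have -> : weights lam n.+1 0 (Ordinal (ltnSn n.+1)) = 1%N.
  by rewrite /= -[in RHS](weights_diag lam n.+1 0) addn0.
by rewrite mul1r mulrDl mul1r mulrDr => /addIr.
Qed.

End Cross.

(** * Chain generating functions *)

Section Chains.
Variables (T : finType) (lt : rel T).
Hypotheses (lt_irr : irreflexive lt) (lt_trans : transitive lt).

Definition chain (A : {set T}) : bool :=
  [forall x in A, forall y in A, [|| x == y, lt x y | lt y x]].

Lemma chainP (A : {set T}) :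
  reflect (forall x y, x \in A -> y \in A -> [|| x == y, lt x y | lt y x])
          (chain A).
Proof.
apply: (iffP forall_inP) => [h x y /h/forall_inP| h x Ax]; first exact.
by apply/forall_inP => y; exact: h.
Qed.

Lemma chainS (A B : {set T}) : A \subset B -> chain B -> chain A.
Proof.
by move=> /subsetP sAB /chainP cB; apply/chainP => x y /sAB Bx /sAB; exact: cB.
Qed.

Definition below y : {set T} := [set w | lt w y].

Definition greatest y (A : {set T}) : bool := (y \in A) && (A :\ y \subset below y).

Lemma greatest_uniq y w A : greatest y A -> greatest w A -> y = w.
Proof.
move=> /andP[Ay /subsetP hy] /andP[Aw /subsetP hw]; apply/eqP/negPn/negP => yw.
have := hw y; have := hy w; rewrite !inE Ay Aw yw eq_sym yw => /(_ isT) h1 /(_ isT) h2.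
by have := lt_trans h1 h2; rewrite lt_irr.
Qed.

Lemma chain_greatest A : chain A -> A != set0 -> exists y, greatest y A.
Proof.
move=> /chainP cA /set0Pn[x0 Ax0].
(* The greatest element is one with the most elements of [A] below it: a [w] above it would count
   all of these and [y] as well. *)
have [y] := arg_maxnP (fun y => #|A :&: below y|) Ax0.
rewrite -/(y \in A) => Ay ymax.
exists y; apply/andP; split=> //; apply/subsetP => w /setD1P[wy Aw].
rewrite inE; have := cA w y Aw Ay; rewrite (negPf wy) /= => /orP[//|ltyw].
have : (#|A :&: below w| <= #|A :&: below y|)%N := ymax w Aw.
rewrite leqNgt => /negP[]; apply: proper_card.
apply/properP; split.
  by apply/subsetP => u; rewrite !inE => /andP[-> /lt_trans->].
by exists y; rewrite !inE ?lt_irr ?andbF // Ay.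
Qed.

(** Nonempty chains are sorted by their greatest element [y], whose removal leaves a chain in
    [below y]. *)
Lemma chain_sum (V : nmodType) (F : {set T} -> V) (D : {set T}) :
  \sum_(A | chain A && (A \subset D)) F A =
  F set0 + \sum_(y in D) \sum_(A | chain A && (A \subset D :&: below y)) F (y |: A).
Proof.
have c0 : chain set0 by apply/chainP => x y; rewrite inE.
rewrite (bigD1 set0) /= ?c0 ?sub0set //; congr (_ + _).
transitivity (\sum_(A | chain A && (A \subset D) && (A != set0))
                \sum_(y | (y \in D) && greatest y A) F A).
  apply: eq_bigr => A /andP[/andP[cA sAD] A0].
  have [y gy] := chain_greatest cA A0.
  rewrite (big_pred1 y) // => w /=.
  apply/andP/eqP => [[_ gw]|->]; first exact: greatest_uniq gw gy.
  by split=> //; rewrite (subsetP sAD) //; case/andP: gy.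
rewrite (exchange_big_dep (fun y => y \in D)) /=; last by move=> A y _ /andP[].
apply: eq_bigr => y Dy.
rewrite (reindex_onto (fun A => y |: A) (fun A => A :\ y)) /=; last first.
  by move=> A /andP[_ /andP[_ /andP[Ay _]]]; rewrite setD1K.
apply: eq_bigl => A; rewrite Dy /= /greatest setU11 /=.
apply/idP/idP => [|/andP[cA]].
  case/andP=> /andP[/andP[/andP[cyA syAD] _] sb] /eqP AE; move: sb; rewrite AE => sb.
  rewrite subsetI sb (chainS _ cyA) ?subsetUr //= andbT.
  by apply: subset_trans syAD; rewrite subsetUr.
rewrite subsetI => /andP[sAD sAy].
have Ay : y \notin A by apply/negP => /(subsetP sAy); rewrite inE lt_irr.
rewrite setU1K // sAy eqxx !andbT subUset sub1set Dy sAD /=.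
apply/andP; split; last by apply/set0Pn; exists y; rewrite setU11.
rewrite andbT; apply/chainP => u v; rewrite !inE.
move=> /predU1P[->|Au] /predU1P[->|Av]; rewrite ?eqxx //.
- by move/subsetP/(_ _ Av): sAy; rewrite inE => ->; rewrite !orbT.
- by move/subsetP/(_ _ Au): sAy; rewrite inE => ->; rewrite !orbT.
by move/chainP: cA; apply.
Qed.

Variables (K : comNzRingType) (z : K).

Definition chain_gf (D : {set T}) : K :=
  \sum_(A | chain A && (A \subset D)) z ^+ #|A|.

Lemma chain_gf_rec D :
  chain_gf D = 1 + \sum_(y in D) z * chain_gf (D :&: below y).
Proof.
rewrite /chain_gf chain_sum cards0 expr0; congr (_ + _).
apply: eq_bigr => y _; rewrite big_distrr /=; apply: eq_bigr => A /andP[_ sA].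
rewrite cardsU1 (contra (subsetP sA y)) ?exprS //.
by rewrite !inE lt_irr andbF.
Qed.

Variables (b : T) (pt : T -> K).
Hypotheses (lt_b : forall y, y != b -> lt b y) (pt_b : pt b = 1).
Hypothesis pt_rec : forall y, y != b -> pt y = z * \sum_(w | lt w y) pt w.

(* Up to the factor [1 + z], [pt y] is the generating function of the chains
   with greatest element [y], except that [pt b = 1] counts the empty chain. *)
Lemma chain_gf_eval : chain_gf [set: T] = (1 + z) * \sum_y pt y.
Proof.
(* Induction on the size needs the claim for all down-sets containing [b], since the recursion
   passes to [below y]. *)
suff gfE (D : {set T}) : b \in D -> (forall y w, y \in D -> lt w y -> w \in D) ->
    chain_gf D = (1 + z) * \sum_(y in D) pt y.
  by rewrite gfE ?inE //; congr (_ * _); apply: eq_bigl => y; rewrite inE.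
have [m] := ubnP #|D|; elim: m D => // m IHm D ltDm Db Dlow.
rewrite chain_gf_rec (bigD1 b) //= [in RHS](bigD1 b) //= pt_b mulrDr mulr1 addrA.
have -> : D :&: below b = set0.
  apply/setP => w; rewrite !inE; apply/negP => /andP[_ ltwb].
  have [wb|/lt_b] := eqVneq w b; first by rewrite wb lt_irr in ltwb.
  by move=> /lt_trans/(_ ltwb); rewrite lt_irr.
(* With nothing below it, [b] contributes only the chain [{b}]; together with the empty chain this
   gives [1 + z]. *)
rewrite chain_gf_rec [X in 1 + X]big1; last by move=> y; rewrite inE.
rewrite addr0 mulr1; congr (_ + _); rewrite big_distrr /=.
apply: eq_bigr => y /andP[Dy yb]; rewrite [in RHS]pt_rec //.
have DyE : D :&: below y = below y.
  by apply/setIidPr/subsetP => w; rewrite inE; exact: Dlow.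
rewrite DyE IHm.
- by rewrite mulrCA; congr (_ * (_ * _)); apply: eq_bigl => w; rewrite inE.
- rewrite -ltnS; apply: leq_trans ltDm; rewrite ltnS; apply: proper_card.
  apply/properP; split; first by rewrite -DyE subsetIl.
  by exists y => //; rewrite inE lt_irr.
- by rewrite inE lt_b.
- by move=> u w; rewrite !inE => ltuy /lt_trans; apply.
Qed.

End Chains.

(** * Posets with prescribed numbers of elements of each rank below a given one *)

Section UniformRank.
Variables (R : rcfType) (z : R[i]) (lam : nat -> nat).
Hypotheses (z_up : 0 < complex.Im z) (lam_gt0 : forall k, (0 < lam k)%N).
Hypothesis lam0 : lam 0 = 1%N.

Lemma weights_eq1 n : weights lam n 0 0 = 1%N.
Proof. by elim: n => // n IHn; rewrite weightsS0 IHn lam0. Qed.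

Lemma diag0 : diag z lam 0 = 1. Proof. by []. Qed.

Lemma addz1_neq0 : 1 + z != 0.
Proof. by apply: contraTneq z_up => z0; rewrite -(addKr 1 z) z0 addr0 /= oppr0 ltxx. Qed.

Variables (T : finType) (lt : rel T) (r : T -> nat) (t : T).
Hypotheses (lt_irr : irreflexive lt) (lt_trans : transitive lt).
Hypothesis t_top : forall y, y != t -> lt y t.
Hypothesis count : forall y k,
  #|[set w | ((w == y) || lt w y) && (r w == k)]| = weights lam (r y) 0 k.

Lemma sum_rank_below y : \sum_(w | (w == y) || lt w y) diag z lam (r w) = tri z lam (r y) 0.
Proof.
rewrite tri_sum; have rle w : (w == y) || lt w y -> (r w <= r y)%N.
  move=> wy; rewrite leqNgt; apply/negP => ltr.
  have /eqP := count y (r w); rewrite weights_small ?addn0 // cards_eq0.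
  by move/eqP/setP/(_ w); rewrite !inE eqxx wy.
transitivity (\sum_(w | (w == y) || lt w y)
   \sum_(k < (r y).+1 | r w == k) diag z lam k).
  apply: eq_bigr => w /rle wy.
  by rewrite (big_pred1 (Ordinal (wy : (r w < (r y).+1)%N))).
rewrite (exchange_big_dep xpredT) //=; apply: eq_bigr => k _.
rewrite -count -sum1dep_card natr_sum mulr_suml.
by apply: eq_bigr => w _; rewrite mul1r.
Qed.

(** With [diag] at the rank of [y] as [pt y], the generating function is [1 + z] times the first
    entry of row [r t], and the entries of a fan are nonzero. *)
Lemma chain_gf_uniform_neq0 : chain_gf lt z [set: T] != 0.
Proof.
(* Since [lam 0 = 1], exactly one element of rank 0 lies weakly below the top, and likewise below
   each [y]: it is the bottom. *)
have [b rb b_unique] : exists2 b, r b = 0%N & forall w, r w = 0%N -> w = b.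
  have /eqP := count t 0; rewrite weights_eq1 => /cards1P[b /setP bE].
  exists b => [|w rw]; first by have := bE b; rewrite !inE eqxx => /andP[_ /eqP].
  apply/eqP; have := bE w; rewrite !inE rw eqxx andbT => <-.
  by case: eqVneq => //= /t_top.
have lt_b y : y != b -> lt b y.
  move=> yb; have /eqP := count y 0; rewrite weights_eq1 => /cards1P[w /setP wE].
  have := wE w; rewrite !inE eqxx => /andP[] /[swap] /eqP/b_unique ->.
  by rewrite eq_sym (negPf yb).
rewrite (chain_gf_eval lt_irr lt_trans lt_b (pt := fun y => diag z lam (r y))).
- have -> : \sum_y diag z lam (r y) = tri z lam (r t) 0.
    rewrite -sum_rank_below; apply: eq_bigl => y.
    by case: eqVneq => //= /t_top.
  by rewrite mulf_neq0 ?addz1_neq0 //; case: (tri_fan z_up lam_gt0 (r t)) => ->.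
- by rewrite rb diag0.
- move=> y yb; case ry : (r y) => [|m]; first by rewrite (b_unique y) ?eqxx in yb.
  have w1 : weights lam m.+1 0 m.+1 = 1%N by have := weights_diag lam m.+1 0; rewrite addn0.
  (* Dropping from the weak lower sum the term of [y] itself, whose weight is one, leaves the sum in
     [diag_rec]. *)
  have := sum_rank_below y; rewrite (bigD1 y) ?eqxx //= tri_sum ry big_ord_recr.
  rewrite /= w1 mul1r addrC => /addIr E; rewrite diag_rec -E; congr (_ * _).
  apply: eq_bigl => w.
  by case: eqVneq => [->|]; rewrite ?lt_irr ?andbT //= andbF.
Qed.

End UniformRank.

(** * From nonvanishing in the upper half-plane to real-rootedness *)

Section RealRooted.
Variable R : realType.

(** Integer coefficients make the set of roots stable under conjugation, so a nonreal root yields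
    one in the upper half-plane. *)
Lemma real_rooted_upper (p : {poly int}) :
  (forall z : R[i], 0 < complex.Im z -> ~~ root (map_poly intr p) z) ->
  real_rooted R p.
Proof.
move=> p_up z pz; apply/eqP; rewrite eq_le !leNgt; apply/andP; split; apply/negP => zI.
  by have := p_up _ zI; rewrite pz.
have /p_up/negP[] : 0 < complex.Im (conjc z) by case: z zI {pz} => a c /=; rewrite oppr_gt0.
suff -> : map_poly intr p = map_poly conjc (map_poly intr p) :> {poly R[i]}.
  by rewrite /root horner_map (eqP pz) rmorph0.
by rewrite -map_poly_comp; apply: eq_map_poly => c /=; rewrite rmorph_int.
Qed.

(** Leaving [lt] free admits both the strict order and its converse, which have the same chains. *)
Lemma chain_poly_gf d (L : finPOrderType d) (lt : rel L) (K : comNzRingType) (z : K) :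
  (forall x y : L, (x >=< y)%O = [|| x == y, lt x y | lt y x]) ->
  (map_poly intr (chain_poly L)).[z] = chain_gf lt z [set: L].
Proof.
move=> ltE; rewrite /chain_poly poly_def rmorph_sum /= horner_sum.
under eq_bigr => k _.
  rewrite -mul_polyC rmorphM /= map_polyC map_polyXn /= hornerM hornerC hornerXn.
  rewrite -[Posz _]natz rmorph_nat /nb_chains -sum1dep_card natr_sum mulr_suml; over.
rewrite (exchange_big_dep (@is_chain d L)) /=; last by move=> k A _ /andP[].
apply: eq_big => [A|A cA].
  rewrite subsetT andbT; apply: eq_forallb => x; congr (_ ==> _).
  by apply: eq_forallb => y; rewrite ltE.
have ltA : (#|A| < #|L|.+1)%N by rewrite ltnS max_card.
rewrite (big_pred1 (Ordinal ltA)) => [|k]; first by rewrite mul1r.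
by rewrite cA eq_sym.
Qed.

Lemma comparable_lt d (L : porderType d) (x y : L) :
  (x >=< y)%O = [|| x == y, (x < y)%O | (y < x)%O].
Proof. by rewrite /Order.comparable !le_eqVlt; case: eqVneq. Qed.

Lemma real_rooted_gf d (L : finPOrderType d) (lt : rel L) :
  (forall x y : L, (x >=< y)%O = [|| x == y, lt x y | lt y x]) ->
  (forall z : R[i], 0 < complex.Im z -> chain_gf lt z [set: L] != 0) ->
  real_rooted R (chain_poly L).
Proof.
move=> ltE gf0; apply: real_rooted_upper => z /gf0.
by rewrite /root (chain_poly_gf z ltE).
Qed.

Lemma real_rooted_uniform d (L : finPOrderType d) (lam : nat -> nat) (r : L -> nat) (t : L) :
  (forall k, (0 < lam k)%N) -> lam 0 = 1%N -> (forall y, (y <= t)%O) ->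
  (forall y k, #|[set w | (w <= y)%O & r w == k]| = weights lam (r y) 0 k) ->
  real_rooted R (chain_poly L).
Proof.
move=> lam_gt0 lam0 t_top count.
apply: (real_rooted_gf (lt := fun x y => (x < y)%O)) => [|z z_up].
  exact: comparable_lt.
apply: (chain_gf_uniform_neq0 z_up lam_gt0 lam0 (r := r) (t := t)).
- exact: ltxx.
- exact: lt_trans.
- by move=> y yt; rewrite lt_neqAle yt t_top.
- by move=> y k; rewrite -count; apply: eq_card => w; rewrite !inE le_eqVlt.
Qed.

Lemma real_rooted_uniform_dual d (L : finPOrderType d) (lam : nat -> nat)
    (r : L -> nat) (t : L) :
  (forall k, (0 < lam k)%N) -> lam 0 = 1%N -> (forall y, (t <= y)%O) ->
  (forall y k, #|[set w | (y <= w)%O & r w == k]| = weights lam (r y) 0 k) ->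
  real_rooted R (chain_poly L).
Proof.
move=> lam_gt0 lam0 t_top count.
apply: (real_rooted_gf (lt := fun x y => (y < x)%O)) => [x y|z z_up].
  by rewrite comparable_lt; congr orb; rewrite orbC.
apply: (chain_gf_uniform_neq0 z_up lam_gt0 lam0 (r := r) (t := t)).
- by move=> x; exact: ltxx.
- by move=> x y w /[swap]; exact: lt_trans.
- by move=> y yt; rewrite lt_neqAle eq_sym yt t_top.
- by move=> y k; rewrite -count; apply: eq_card => w; rewrite !inE le_eqVlt eq_sym.
Qed.

End RealRooted.

(** * Subspace lattices *)

(** Tuples grow by prepending, and the number of admissible extensions depends on the length only.
    This serves linearly independent families and signed-free ones alike. *)
Lemma card_indep_tuples (X : finType) (ok : pred (seq X)) (c : nat -> nat) (m n : nat) :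
  ok [::] -> (forall x s, ok (x :: s) -> ok s) ->
  (forall s, ok s -> #|[set x | ok (x :: s)]| = (m - c (size s))%N) ->
  #|[set s : n.-tuple X | ok s]| = (\prod_(i < n) (m - c i))%N.
Proof.
move=> ok0 okS okc; elim: n => [|n IHn].
  rewrite big_ord0 -[RHS](cards1 ([tuple] : 0.-tuple X)); apply: eq_card => s.
  by rewrite [s]tuple0 !inE ok0 eqxx.
rewrite big_ord_recr /= -IHn -sum1dep_card.
rewrite (partition_big (fun s : n.+1.-tuple X => [tuple of behead s])
  (fun s : n.-tuple X => ok s)) /=.
  rewrite -sum1dep_card big_distrl /=; apply: eq_bigr => s oks.
  have := okc s oks; rewrite size_tuple mul1n => <-; rewrite -sum1dep_card.
  rewrite (reindex_onto (fun x => [tuple of x :: s]) (fun s' : n.+1.-tuple X => thead s')) /=.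
    apply: eq_bigl => x; rewrite theadE eqxx andbT.
    suff -> : [tuple of behead [tuple of x :: s]] == s by rewrite andbT.
    exact/eqP/val_inj.
  by move=> s' /andP[_ /eqP<-]; rewrite -tuple_eta.
by move=> s; case: (tupleP s) => x s' /okS.
Qed.

Lemma newton_shift_expn q k n :
  newton (expn q) k.+1 n.+1 = ((q ^ n.+1 - 1) * q ^ k * newton (expn q) k n)%N.
Proof.
rewrite /newton big_ord_recl -mulnA; congr muln.
under eq_bigr => i _ do rewrite lift0 !expnS -mulnBr.
by rewrite big_split /= prod_nat_const card_ord.
Qed.

(** [weights (expn q) n 0 k] is the Gaussian binomial coefficient, with [weightsSS] as its Pascal
    rule; the quotient formula is multiplied out to stay in [nat]. *)
Lemma weights_expn q n k : (1 < q)%N ->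
  (weights (expn q) n 0 k * newton (expn q) k k = newton (expn q) k n)%N.
Proof.
move=> q_gt1; elim: n k => [|n IHn] [|k].
- by rewrite /newton !big_ord0.
- by rewrite weights_small // [RHS]newton_eq0.
- by rewrite weights_eq1 // /newton !big_ord0.
rewrite weightsSS mulnDl -[in X in (_ + X)%N]mulnA IHn !newton_shift_expn.
rewrite mulnCA IHn /newton [in X in (_ + X)%N]big_ord_recr /= -/(newton _ k n).
have [lekn|ltnk] := leqP k n; last by rewrite newton_eq0 // !muln0.
have q0 := ltnW q_gt1.
rewrite [(newton _ k n * _)%N]mulnC mulnA -mulnDl; congr muln.
apply/eqP; rewrite -eqz_nat !PoszD !PoszM -!subzn ?leq_pexp2l ?expn_gt0 ?q0 //.
by rewrite !expnS !PoszM; apply/eqP; ring.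
Qed.

Lemma card_mem_vspace (F : finFieldType) (V : vectType F) (W : {vspace V}) :
  #|[set v : finvect_type V | (v : V) \in W]| = (#|F| ^ \dim W)%N.
Proof.
rewrite cardsE; case: V W => T c W.
exact: (@card_vspace F (finvect_type (Vector.Pack c)) c W).
Qed.

Section SubspaceCount.
Variables (F : finFieldType) (V : vectType F).
Local Notation q := #|F|.

Definition free_in (W : {vspace V}) : pred (seq (finvect_type V)) :=
  fun s => free (s : seq V) && all (fun v : V => v \in W) s.

(** A free family in [W] is extended by exactly the vectors of [W] outside its span. *)
Lemma card_free_in (W : {vspace V}) k :
  #|[set s : k.-tuple (finvect_type V) | free_in W s]| = newton (expn q) k (\dim W).
Proof.
apply: card_indep_tuples => [|v s|s /andP[frs sW]].
- by rewrite /free_in /= nil_free.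
- by rewrite /free_in /= free_cons => /andP[/andP[_ ->] /andP[_ ->]].
have /eqP dims : \dim <<(s : seq V)>> == size s := frs.
have sWs : (<<(s : seq V)>> <= W)%VS by apply/span_subvP => v /(allP sW).
rewrite -dims -!card_mem_vspace -cardsDS.
  by apply: eq_card => v; rewrite !inE /free_in /= free_cons frs sW !andbT.
by apply/subsetP => v; rewrite !inE; apply: subvP.
Qed.

(** Free [k]-tuples in [W] are grouped by their span: each [k]-dimensional subspace is spanned by
    [newton (expn q) k k] of them. *)
Lemma card_subspaces (W : subspaces V) k :
  #|[set U : subspaces V | (U <= W)%O && (\dim (U : {vspace V}) == k)]| =
  weights (expn q) (\dim (W : {vspace V})) 0 k.
Proof.
have q_gt1 : (1 < q)%N := finNzRing_gt1 F.
have newton0 : (0 < newton (expn q) k k)%N.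
  by apply: newton_gt0 => // i j ltij; rewrite ltn_exp2l.
apply/eqP; rewrite -(eqn_pmul2r newton0) weights_expn // -card_free_in.
rewrite -sum1dep_card [in eqbRHS]/= -sum1dep_card.
rewrite (partition_big (fun s : k.-tuple (finvect_type V) => <<(s : seq V)>>%VS : subspaces V)
  (fun U : subspaces V => (U <= W)%O && (\dim (U : {vspace V}) == k))) /=.
  rewrite big_distrl /=; apply/eqP; apply: eq_bigr => U /andP[sUW /eqP dimU].
  have := card_free_in (U : {vspace V}) k; rewrite dimU -sum1dep_card mul1n => <-.
  apply: eq_bigl => s; rewrite /free_in.
  have [frs|] //= := boolP (free (s : seq V)).
  apply/idP/andP => [sU|[sW /eqP <-]]; last first.
    by apply/allP => v; exact: memv_span.
  have sUs : (<<(s : seq V)>> <= U)%VS by apply/span_subvP => v /(allP sU).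
  split; last first.
    by apply/eqP/eqP; rewrite eqEdim sUs dimU (eqP frs) size_tuple leqnn.
  by apply/allP => v /(allP sU); apply/subvP.
move=> s /andP[frs sW]; apply/andP; split.
  by apply/span_subvP => v /(allP sW).
by rewrite (eqP frs) size_tuple.
Qed.

Lemma real_rooted_subspaces (R : realType) : real_rooted R (chain_poly (subspaces V)).
Proof.
apply: (real_rooted_uniform (lam := expn q) (r := fun U : subspaces V => \dim (U : {vspace V}))
  (t := fullv : subspaces V)).
- by move=> k; rewrite expn_gt0 ltnW ?finNzRing_gt1.
- by [].
- by move=> U; exact: subvf.
- exact: card_subspaces.
Qed.

End SubspaceCount.

(** * Partition lattices *)

Section Kernels.
Variable T : finType.
Implicit Types P Q : setpart T.

Definition class_of P x : {set T} := pblock (blocks P) x.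

Lemma cover_setpart P x : x \in cover (blocks P).
Proof. by rewrite (cover_partition (setpartP P)) inE. Qed.

Lemma class_in P x : class_of P x \in blocks P.
Proof. exact: pblock_mem (cover_setpart P x). Qed.

Lemma mem_class P x : x \in class_of P x.
Proof. by rewrite /class_of mem_pblock cover_setpart. Qed.

Lemma class_def P B x : B \in blocks P -> x \in B -> class_of P x = B.
Proof. by move=> PB; apply: def_pblock PB; case/and3P: (setpartP P). Qed.

Lemma in_class P x y : (y \in class_of P x) = (class_of P x == class_of P y).
Proof.
by rewrite /class_of eq_pblock ?cover_setpart //; case/and3P: (setpartP P).
Qed.

Lemma block_repr P B : B \in blocks P -> exists x, class_of P x = B.
Proof.
move=> PB; have [B0|[x Bx]] := set_0Vmem B.
  by case/and3P: (setpartP P) => _ _ /negP[]; rewrite -B0.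
by exists x; exact: class_def.
Qed.

Lemma le_setpartP P Q :
  reflect (forall x y, class_of P x = class_of P y -> class_of Q x = class_of Q y)
          (P <= Q)%O.
Proof.
apply: (iffP (refinesP P Q)) => [le_PQ x y xy|le_PQ B PB].
  have [C QC /subsetP sC] := le_PQ _ (class_in P x).
  rewrite (class_def QC (sC _ (mem_class P x))).
  by rewrite (class_def QC (sC y _)) // xy mem_class.
have [x xB] := block_repr PB; exists (class_of Q x); first exact: class_in.
by apply/subsetP => y; rewrite -xB !in_class => /eqP/le_PQ->.
Qed.

Variable X : finType.
Implicit Type f : {ffun T -> X}.

Definition kernel f : setpart T := Setpart (preim_partitionP f [set: T]).

Lemma class_kernel f x y :
  (class_of (kernel f) x == class_of (kernel f) y) = (f x == f y).
Proof.
rewrite -in_class /class_of /kernel /= pblock_equivalence_partition ?inE //.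
by split=> // /eqP->.
Qed.

Lemma le_kernelP P f :
  reflect (forall x y, class_of P x = class_of P y -> f x = f y) (P <= kernel f)%O.
Proof.
apply: (iffP (le_setpartP P _)) => h x y /h/eqP; rewrite ?class_kernel => /eqP //.
by move=> fxy; apply/eqP; rewrite class_kernel fxy.
Qed.

Lemma kernel_eqP P f :
  reflect (forall x y, (f x == f y) = (class_of P x == class_of P y)) (kernel f == P).
Proof.
apply: (iffP eqP) => [<- x y|fP]; first by rewrite class_kernel.
apply: le_anti; apply/andP; split.
  by apply/le_setpartP => x y /eqP; rewrite class_kernel fP => /eqP.
by apply/le_setpartP => x y /eqP; rewrite -fP -class_kernel => /eqP.
Qed.

End Kernels.

(** The partition into singletons is the bottom; it serves as the top of the dual order. *)
Lemma kernel_id (T : finType) (P : setpart T) : (kernel (finfun (@id T)) <= P)%O.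
Proof. by apply/le_setpartP => x y /eqP; rewrite class_kernel !ffunE => /eqP->. Qed.

Section PartitionCount.
Variables (T : finType) (X : finType).
Implicit Types P Q : setpart T.

Local Notation block P := {B : {set T} | B \in blocks P}.

Definition block_of P x : block P := exist _ (class_of P x) (class_in P x).

Definition spread P (g : {ffun block P -> X}) : {ffun T -> X} :=
  [ffun x => g (block_of P x)].

Lemma block_ofP P (b : block P) : exists x, block_of P x == b.
Proof.
case: b => B PB; have [x xB] := block_repr PB.
by exists x; apply/eqP/val_inj.
Qed.

Lemma spread_inj P : injective (@spread P).
Proof.
move=> g h /ffunP gh; apply/ffunP => b; have [x /eqP <-] := block_ofP b.
by have := gh x; rewrite !ffunE.
Qed.

(** Through [spread], the maps constant on the blocks are the functions on the set of blocks; those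
    with kernel exactly [P] will be the injective ones. *)
Lemma card_le_kernel P :
  #|[set f : {ffun T -> X} | (P <= kernel f)%O]| = (#|X| ^ #|blocks P|)%N.
Proof.
rewrite -[#|blocks P|]card_sig -card_ffun -(card_imset _ (@spread_inj P)).
apply: eq_card => f; rewrite inE; apply/le_kernelP/imsetP => [fP|[g _ ->] x y xy].
  exists [ffun b : block P => f (xchoose (block_ofP b))] => //; apply/ffunP => x.
  rewrite !ffunE; apply: fP.
  by have /eqP/(congr1 val) := xchooseP (block_ofP (block_of P x)).
by rewrite !ffunE; congr (g _); apply: val_inj.
Qed.

Lemma card_eq_kernel P : #|[set f : {ffun T -> X} | kernel f == P]| = (#|X| ^_ #|blocks P|)%N.
Proof.
rewrite -[#|blocks P|]card_sig -card_inj_ffuns -(card_imset _ (@spread_inj P)).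
apply: eq_card => f; rewrite inE.
apply/idP/imsetP => [fP|[g + ->]].
  have /le_kernelP lef : (P <= kernel f)%O by rewrite (eqP fP).
  have gE x : f (xchoose (block_ofP (block_of P x))) = f x.
    by apply: lef; have /eqP/(congr1 val) := xchooseP (block_ofP (block_of P x)).
  exists [ffun b : block P => f (xchoose (block_ofP b))].
    rewrite inE; apply/injectiveP => b c; have [x /eqP <-] := block_ofP b.
    have [y /eqP <-] := block_ofP c; rewrite !ffunE !gE => /eqP.
    by rewrite (kernel_eqP _ _ fP) => /eqP xy; apply: val_inj.
  by apply/ffunP => x; rewrite !ffunE gE.
rewrite inE => /injectiveP g_inj; apply/kernel_eqP => x y; rewrite !ffunE.
by rewrite (inj_eq g_inj) -val_eqE.
Qed.

Lemma sum_coarser P : (#|X| ^ #|blocks P| = \sum_(Q | (P <= Q)%O) #|X| ^_ #|blocks Q|)%N.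
Proof.
rewrite -card_le_kernel -sum1dep_card.
rewrite (partition_big (@kernel T X) (fun Q => (P <= Q)%O)) //=.
apply: eq_bigr => Q PQ; rewrite -card_eq_kernel -sum1dep_card.
by apply: eq_bigl => f; case: eqP => [->|]; rewrite ?PQ ?andbF.
Qed.

End PartitionCount.

Section PartitionLattice.
Variable n : nat.
Hypothesis n_gt0 : (0 < n)%N.

Lemma blocks_gt0 (P : Pi n) : (0 < #|blocks P|)%N.
Proof.
by rewrite card_gt0; apply/set0Pn; exists (class_of P (Ordinal n_gt0)); exact: class_in.
Qed.

Lemma newton_succn k m : newton succn k m = (m ^_ k)%N.
Proof. by rewrite ffact_prod; apply: eq_bigr => i _; rewrite subSS. Qed.

Lemma card_coarser (P : Pi n) k :
  #|[set Q : Pi n | (P <= Q)%O & (#|blocks Q|.-1 == k)]| = weights succn #|blocks P|.-1 0 k.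
Proof.
apply: (newton_count (lam := succn)) => // m.
(* The rank is the number of blocks minus one, so [sum_coarser] with [m.+1] values has one exponent
   too many; the common factor [m.+1] is divided out. *)
apply/eqP; rewrite -(eqn_pmul2l (ltn0Sn m)) -expnS prednK ?blocks_gt0 //.
have := sum_coarser 'I_m.+1 P; rewrite card_ord big_distrr => -> /=.
apply/eqP/eq_bigr => Q _.
by rewrite newton_succn -ffactSS prednK ?blocks_gt0.
Qed.

Lemma real_rooted_Pi (R : realType) : real_rooted R (chain_poly (Pi n)).
Proof.
apply: (real_rooted_uniform_dual (lam := succn) (r := fun P : Pi n => #|blocks P|.-1)
  (t := kernel (finfun id) : Pi n)) => //.
- exact: kernel_id.
- exact: card_coarser.
Qed.

End PartitionLattice.

(** * Partitions of type B *)

Section Signed.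
Variable n : nat.
Local Notation opp := (@signed_opp n).
Local Notation "00" := (signed0 n).

Lemma signed_oppK : involutive opp.
Proof. exact: rev_ordK. Qed.

Lemma signed_opp_eq (x : signed n) : (opp x == x) = (x == 00).
Proof.
apply/eqP/eqP => [/(congr1 (@signed_val n))|->].
  rewrite signed_val_opp => x0; apply: signed_val_inj; rewrite signed_val0; lia.
by apply: signed_val_inj; rewrite signed_val_opp signed_val0 oppr0.
Qed.

Lemma signed_opp0 : opp 00 = 00.
Proof. by apply/eqP; rewrite signed_opp_eq. Qed.

(** The entries are nonzero with pairwise distinct absolute values. *)
Definition signed_free (s : seq (signed n)) : bool := uniq (00 :: s ++ map opp s).

Lemma signed_free_cons x s :
  signed_free (x :: s) = (x \notin 00 :: s ++ map opp s) && signed_free s.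
Proof.
rewrite /signed_free; set L := 00 :: s ++ map opp s.
have -> : uniq (00 :: (x :: s) ++ map opp (x :: s)) = uniq [:: x, opp x & L].
  apply: perm_uniq; rewrite /L /=; apply/permP => a /=; rewrite !count_cat /=; lia.
have oppL y : (opp y \in L) = (y \in L).
  have inj_opp := inv_inj signed_oppK.
  have -> : (y \in L) = [|| y == 00, opp y \in map opp s | opp y \in s].
    by rewrite inE mem_cat -[in y \in map _ _](signed_oppK y) !mem_map.
  by rewrite inE mem_cat -[in LHS]signed_opp0 (inj_eq inj_opp) [X in _ || X]orbC.
(* As [L] is stable under [opp], it avoids [opp x] once it avoids [x]; and [x] differs from [opp x]
   because 0 is in [L]. *)
rewrite 2!cons_uniq inE oppL negb_or; have [|xL] /= := boolP (x \in L).
  by rewrite andbF.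
rewrite andbT eq_sym signed_opp_eq.
by case: eqP xL => // ->; rewrite mem_head.
Qed.

Lemma card_signed_free k :
  #|[set s : k.-tuple (signed n) | signed_free s]| =
  newton (fun i => i.*2.+1) k n.
Proof.
apply: card_indep_tuples => [//|x s|s free_s].
  by rewrite signed_free_cons => /andP[].
under eq_finset => x do rewrite signed_free_cons free_s andbT.
have -> : (size s).*2.+1 = #|00 :: s ++ map opp s|.
  by rewrite (card_uniqP free_s) /= size_cat size_map addnn.
have := cardC (mem (00 :: s ++ map opp s)).
rewrite card_ord => <-; rewrite addKn.
by apply: eq_card => x; rewrite !inE.
Qed.

Lemma card_signed_free_ffun (K : finType) :
  #|[set g : {ffun K -> signed n} | signed_free (codom g)]| =
  newton (fun i => i.*2.+1) #|K| n.
Proof.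
rewrite -card_signed_free.
have bijFF : {on (_ : pred _), bijective (@Finfun K (signed n))}.
  by exists (fun f => fgraph f) => x _; [apply: FinfunK | apply: fgraphK].
rewrite -(on_card_preimset (bijFF _)); apply: eq_card => /= t.
by rewrite !inE -[t in RHS]FinfunK -codom_ffun.
Qed.

Lemma signed_freeP (K : finType) (g : {ffun K -> signed n}) :
  reflect [/\ forall b, g b != 00, injective g & forall b c, g b != opp (g c)]
          (signed_free (codom g)).
Proof.
rewrite /signed_free cons_uniq mem_cat negb_or cat_uniq.
rewrite (map_inj_uniq (inv_inj signed_oppK)).
apply: (iffP idP) => [|[g0 g_inj gN]].
  case/and3P=> /andP[g0 _] /injectiveP g_inj /andP[/hasPn gN _].
  split=> // [b|b c]; first by apply: contraNneq g0 => <-; exact: codom_f.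
  apply/eqP => gbc; have /gN/negP[] : opp (g c) \in map opp (codom g).
    by rewrite map_f ?codom_f.
  by rewrite -gbc; exact: codom_f.
have -> : uniq (codom g) by apply/injectiveP.
rewrite !andbT /=; apply/andP; split.
  apply/andP; split; first by apply/codomP => -[b E]; have := g0 b; rewrite -E eqxx.
  apply/mapP => -[_ /codomP[b ->]] E.
  by have := g0 b; rewrite -signed_opp_eq -E -(signed_oppK (g b)) -E signed_opp0 eqxx.
apply/hasPn => _ /mapP[_ /codomP[c ->] ->]; apply/codomP => -[b E].
by have := gN b c; rewrite E eqxx.
Qed.

End Signed.

Section TypeB.
Variable n : nat.
Local Notation opp := (@signed_opp n).
Local Notation "00" := (signed0 n).

Lemma class_opp (P : PiB n) x : class_of P (opp x) = opp @: class_of P x.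
Proof.
have /andP[/forall_inP oppP _] := PiB_typeB P.
by apply: class_def; [exact: oppP (class_in P x) | exact: imset_f (mem_class P x)].
Qed.

(** [typeB] constrains positive elements only: a negative [x] is replaced by [opp x], and [x = 0] is
    immediate. *)
Lemma class_opp_fix (P : PiB n) x :
  class_of P (opp x) = class_of P x -> class_of P x = class_of P 00.
Proof.
have /andP[_ /forall_inP zeroP] := PiB_typeB P.
have gt0P y : 0 < signed_val y -> class_of P (opp y) = class_of P y ->
    class_of P y = class_of P 00.
  move=> y0 yy; apply/eqP; rewrite -in_class.
  have /forallP/(_ y) := zeroP _ (class_in P y).
  by rewrite y0 mem_class !in_class yy eqxx.
case: (ltrgtP (signed_val x) 0) => [x0|x0|x0] xx.
- rewrite -xx; apply: gt0P; first by rewrite signed_val_opp oppr_gt0.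
  by rewrite signed_oppK.
- exact: gt0P.
- by congr class_of; apply: signed_val_inj; rewrite signed_val0.
Qed.

(* Enumerating all subsets selects one block out of each pair [B, -B] of
   distinct blocks. *)
Definition positive (B : {set signed n}) : bool :=
  (enum_rank B < enum_rank (opp @: B))%N.

Definition posblock (P : PiB n) : Type :=
  {B : {set signed n} | (B \in blocks P) && positive B}.
HB.instance Definition _ P := Finite.on (posblock P).

Definition Posblock (P : PiB n) B (PB : (B \in blocks P) && positive B) : posblock P :=
  exist _ B PB.

(** Counts the pairs of opposite blocks other than the zero block. *)
Definition rankB (P : PiB n) : nat := #|{: posblock P}|.

Section Spread.
Variables (P : PiB n) (m : nat).
Local Notation block := (posblock P).

Lemma opp_imsetK : involutive (fun B : {set signed n} => opp @: B).
Proof.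
move=> B; rewrite -imset_comp -[RHS]imset_id; apply: eq_imset => x /=.
exact: signed_oppK.
Qed.

Lemma posblock_repr (b : block) : exists x, class_of P x == val b.
Proof. by have /andP[/block_repr[x <-] _] := valP b; exists x. Qed.

Lemma posblock_opp (b c : block) x : class_of P x = val b -> class_of P (opp x) != val c.
Proof.
rewrite class_opp => ->; apply/eqP => bc.
have /andP[_] := valP c; rewrite /positive -bc opp_imsetK.
by have /andP[_ /ltnW] := valP b; rewrite leqNgt => /negP.
Qed.

Lemma posblock0 (b : block) : class_of P 00 != val b.
Proof.
by apply/eqP => b0; have := posblock_opp b b0; rewrite signed_opp0 b0 eqxx.
Qed.

Variant sign_spec x : Prop :=
| SignPos (b : block) of class_of P x = val b
| SignNeg (b : block) of class_of P (opp x) = val b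
| SignZero of class_of P x = class_of P 00.

Lemma signP x : sign_spec x.
Proof.
case: (ltngtP (enum_rank (class_of P x)) (enum_rank (class_of P (opp x)))) => [ltx|ltx|eqx].
- have Px : (class_of P x \in blocks P) && positive (class_of P x).
    by rewrite class_in /positive -class_opp.
  exact: (@SignPos x (Posblock Px) erefl).
- have Px : (class_of P (opp x) \in blocks P) && positive (class_of P (opp x)).
    by rewrite class_in /positive -class_opp signed_oppK.
  exact: (@SignNeg x (Posblock Px) erefl).
- by apply: SignZero; apply/class_opp_fix/esym/enum_rank_inj/val_inj.
Qed.

Implicit Types (g : {ffun block -> signed m}) (f : {ffun signed n -> signed m}).

(** Oddness dictates the extension: the opposite of a chosen block gets the opposite value, and the
    zero block, being its own opposite, gets 0. *)
Definition spreadB g : {ffun signed n -> signed m} :=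
  [ffun x => if insub (class_of P x) is Some b then g b
             else if insub (class_of P (opp x)) is Some b then signed_opp (g b)
             else signed0 m].

Lemma insub_posblock (b : block) B : B = val b -> insub B = Some b.
Proof. by move=> ->; rewrite valK. Qed.

Lemma insub_posblockN B : (forall b : block, B != val b) -> insub B = None :> option block.
Proof. by move=> Bb; case: insubP => // b _ E; have := Bb b; rewrite E eqxx. Qed.

Lemma spreadB_pos g x b : class_of P x = val b -> spreadB g x = g b.
Proof. by rewrite ffunE => /insub_posblock->. Qed.

Lemma spreadB_neg g x b : class_of P (opp x) = val b -> spreadB g x = signed_opp (g b).
Proof.
move=> xb; rewrite ffunE insub_posblockN => [|c].
  by rewrite (insub_posblock xb).
by have := posblock_opp c xb; rewrite signed_oppK.
Qed.

Lemma class_zero_opp x : class_of P x = class_of P 00 -> class_of P (opp x) = class_of P 00.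
Proof. by rewrite class_opp => ->; rewrite -class_opp signed_opp0. Qed.

Lemma spreadB_zero g x : class_of P x = class_of P 00 -> spreadB g x = signed0 m.
Proof.
move=> x0; rewrite ffunE !insub_posblockN // => b.
  by rewrite class_zero_opp ?posblock0.
by rewrite x0 posblock0.
Qed.

Definition odd_ffun (f : {ffun signed n -> signed m}) : bool :=
  [forall x, f (opp x) == signed_opp (f x)].

Lemma odd_ffunP f : reflect (forall x, f (opp x) = signed_opp (f x)) (odd_ffun f).
Proof. exact: eqfunP. Qed.

Lemma odd_ffun0 f : odd_ffun f -> f 00 = signed0 m.
Proof.
by move/odd_ffunP/(_ 00); rewrite signed_opp0 => /esym/eqP; rewrite signed_opp_eq => /eqP.
Qed.

Lemma spreadB_odd g : odd_ffun (spreadB g).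
Proof.
apply/odd_ffunP => x; case: (signP x) => [b xb|b xb|x0].
- by rewrite (spreadB_pos g xb) (@spreadB_neg g _ b) // signed_oppK.
- by rewrite (spreadB_neg g xb) (spreadB_pos g xb) signed_oppK.
- by rewrite !spreadB_zero ?signed_opp0 //; exact: class_zero_opp.
Qed.

Lemma spreadB_inj : injective spreadB.
Proof.
move=> g h gh; apply/ffunP => b; have [x /eqP xb] := posblock_repr b.
by rewrite -(spreadB_pos g xb) gh (spreadB_pos h xb).
Qed.

Lemma spreadB_le g : (PiB_part P <= kernel (spreadB g))%O.
Proof. by apply/le_kernelP => x y xy; rewrite !ffunE !class_opp xy. Qed.

Definition gather (f : {ffun signed n -> signed m}) : {ffun block -> signed m} :=
  [ffun b => f (xchoose (posblock_repr b))].

Lemma gatherK f : odd_ffun f -> (PiB_part P <= kernel f)%O -> spreadB (gather f) = f.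
Proof.
move=> f_odd /le_kernelP fP; apply/ffunP => x.
have fE b y : class_of P y = val b -> f (xchoose (posblock_repr b)) = f y.
  by move=> yb; apply: fP; rewrite yb; apply/eqP/(xchooseP (posblock_repr b)).
case: (signP x) => [b xb|b xb|x0].
- by rewrite (spreadB_pos _ xb) ffunE (fE _ _ xb).
- by rewrite (spreadB_neg _ xb) ffunE (fE _ _ xb) (odd_ffunP _ f_odd) signed_oppK.
- by rewrite spreadB_zero // (fP _ _ x0) odd_ffun0.
Qed.

Lemma card_odd_le_kernel :
  #|[set f | odd_ffun f & (PiB_part P <= kernel f)%O]| = (m.*2.+1 ^ rankB P)%N.
Proof.
rewrite -[m.*2.+1]card_ord -card_ffun -(card_imset _ spreadB_inj).
apply: eq_card => f; rewrite inE; apply/andP/imsetP => [[f_odd fP]|[g _ ->]].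
  by exists (gather f); rewrite ?gatherK.
by rewrite spreadB_odd spreadB_le.
Qed.

(** Blocks coalesce in the kernel exactly when a value is 0 or the values at two chosen blocks agree
    up to sign. *)
Lemma kernel_spreadB g : (kernel (spreadB g) == PiB_part P) = signed_free (codom g).
Proof.
apply/kernel_eqP/signed_freeP => [gP|[g0 g_inj gN] x y].
  have gE b c x y : class_of P x = val b -> class_of P y = val c ->
      (g b == g c) = (val b == val c).
    by move=> xb yc; rewrite -(spreadB_pos g xb) -(spreadB_pos g yc) gP xb yc.
  split=> [b|b c|b c].
  - have [x /eqP xb] := posblock_repr b.
    by rewrite -(spreadB_pos g xb) -(@spreadB_zero g 00) // gP xb eq_sym posblock0.
  - have [x /eqP xb] := posblock_repr b; have [y /eqP yc] := posblock_repr c.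
    by move/eqP; rewrite (gE _ _ _ _ xb yc) => /eqP/val_inj.
  - have [x /eqP xb] := posblock_repr b; have [y /eqP yc] := posblock_repr c.
    rewrite -(spreadB_pos g xb) -(spreadB_pos g yc) -(odd_ffunP _ (spreadB_odd g)) gP.
    by rewrite xb eq_sym (posblock_opp _ yc).
have inj_opp := inv_inj (@signed_oppK m).
have class_oppE u v : (class_of P (opp u) == class_of P (opp v)) = (class_of P u == class_of P v).
  by rewrite !class_opp (inj_eq (inv_inj opp_imsetK)).
(* Each of [x] and [y] lies in a chosen block, in the opposite of one, or in the zero block. *)
case: (signP x) => [b xb|b xb|x0]; case: (signP y) => [c yc|c yc|y0].
- by rewrite (spreadB_pos g xb) (spreadB_pos g yc) (inj_eq g_inj) xb yc -val_eqE.
- rewrite (spreadB_pos g xb) (spreadB_neg g yc) (negPf (gN _ _)) xb.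
  by apply/esym/negbTE; rewrite eq_sym -(signed_oppK y) (posblock_opp _ yc).
- by rewrite (spreadB_pos g xb) (spreadB_zero g y0) (negPf (g0 _)) xb y0 eq_sym
     (negPf (posblock0 _)).
- rewrite (spreadB_neg g xb) (spreadB_pos g yc) eq_sym (negPf (gN _ _)) yc.
  by apply/esym/negbTE; rewrite -(signed_oppK x) (posblock_opp _ xb).
- by rewrite (spreadB_neg g xb) (spreadB_neg g yc) (inj_eq inj_opp) (inj_eq g_inj)
     -class_oppE xb yc -val_eqE.
- rewrite (spreadB_neg g xb) (spreadB_zero g y0) -[X in _ == X]signed_opp0 (inj_eq inj_opp).
  rewrite (negPf (g0 _)) -class_oppE xb class_zero_opp //.
  by rewrite eq_sym (negPf (posblock0 _)).
- by rewrite (spreadB_zero g x0) (spreadB_pos g yc) eq_sym (negPf (g0 _)) x0 yc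
     (negPf (posblock0 _)).
- rewrite (spreadB_zero g x0) (spreadB_neg g yc) -[X in X == _]signed_opp0 (inj_eq inj_opp).
  by rewrite eq_sym (negPf (g0 _)) -class_oppE yc class_zero_opp // (negPf (posblock0 _)).
- by rewrite !spreadB_zero // x0 y0 !eqxx.
Qed.

Lemma card_odd_eq_kernel :
  #|[set f | odd_ffun f & kernel f == PiB_part P]| = newton (fun i => i.*2.+1) (rankB P) m.
Proof.
rewrite -card_signed_free_ffun -(card_imset _ spreadB_inj).
apply: eq_card => f; rewrite inE; apply/andP/imsetP => [[f_odd fP]|[g]].
  have fE : spreadB (gather f) = f by rewrite gatherK // (eqP fP).
  by exists (gather f); rewrite // inE -kernel_spreadB fE.
by rewrite inE -kernel_spreadB => gP ->; rewrite spreadB_odd.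
Qed.

End Spread.

(** A value [f y] equal to its opposite is 0, hence the value of [f] at 0; this puts 0 in the block
    of [y]. *)
Lemma typeB_kernel m (f : {ffun signed n -> signed m}) : odd_ffun f -> typeB (kernel f).
Proof.
move=> f_odd; have fN := odd_ffunP _ f_odd; apply/andP; split.
  apply/forall_inP => B /block_repr[x <-].
  suff -> : opp @: class_of (kernel f) x = class_of (kernel f) (opp x) by exact: class_in.
  apply/setP => y; rewrite -[y]signed_oppK mem_imset; last exact: inv_inj (@signed_oppK n).
  by rewrite !in_class !class_kernel !fN (inj_eq (inv_inj (@signed_oppK m))).
apply/forall_inP => B /block_repr[x <-]; apply/forallP => y; apply/implyP.
rewrite !in_class !class_kernel fN => /andP[/andP[_ /eqP->] /eqP fy].
by rewrite odd_ffun0 // -signed_opp_eq -fy.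
Qed.

Lemma sum_coarserB (P : PiB n) m :
  (m.*2.+1 ^ rankB P = \sum_(Q | (P <= Q)%O) newton (fun i => i.*2.+1) (rankB Q) m)%N.
Proof.
rewrite -card_odd_le_kernel -sum1dep_card.
(* The default [P] is never returned for an odd map, whose kernel is of type B. *)
pose ker (f : {ffun signed n -> signed m}) : PiB n := insubd P (kernel f).
have kerE f : odd_ffun f -> PiB_part (ker f) = kernel f.
  by move=> f_odd; apply: insubdK; exact: typeB_kernel.
rewrite (partition_big ker (fun Q => (P <= Q)%O)) /= => [|f /andP[f_odd]]; last first.
  by rewrite -(kerE f).
apply: eq_bigr => Q PQ; rewrite -card_odd_eq_kernel -sum1dep_card.
apply: eq_bigl => f; rewrite -andbA; case f_odd: (odd_ffun f) => //=.
rewrite -val_eqE /= kerE //; case: eqP => [->|]; rewrite ?andbF // andbT.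
exact: PQ.
Qed.

Lemma card_coarserB (P : PiB n) k :
  #|[set Q : PiB n | (P <= Q)%O & (rankB Q == k)]| =
  weights (fun i => i.*2.+1) (rankB P) 0 k.
Proof.
apply: (newton_count (lam := fun i => i.*2.+1)) => [i j|m]; last exact: sum_coarserB.
by rewrite ltnS ltn_double.
Qed.

Lemma real_rooted_PiB (R : realType) : real_rooted R (chain_poly (PiB n)).
Proof.
have id_odd : odd_ffun (finfun (@id (signed n))).
  by apply/odd_ffunP => x; rewrite !ffunE.
apply: (real_rooted_uniform_dual (lam := fun i => i.*2.+1) (r := rankB)
  (t := MkPiB (typeB_kernel id_odd))) => //.
- move=> P; exact: kernel_id.
- exact: card_coarserB.
Qed.

End TypeB.

(** * Uniform matroids *)

Section SubsetSums.
Variables (E : finType) (K : pzRingType).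

Lemma sum_card_lt (B : {set E}) (f : nat -> K) k :
  \sum_(A : {set E} | (A \subset B) && (#|A| < k)%N) f #|A| =
  \sum_(j < k) ('C(#|B|, j))%:R * f j.
Proof.
case: k => [|k]; first by rewrite big_ord0 big_pred0 // => A; rewrite andbF.
rewrite (partition_big (fun A : {set E} => inord #|A| : 'I_k.+1) xpredT) //=.
apply: eq_bigr => j _; rewrite -cards_draws -sum1dep_card natr_sum mulr_suml.
apply: eq_big => [A|A /andP[/andP[_ ltAk] /eqP<-]]; last by rewrite inordK // mul1r.
rewrite -andbA; congr (_ && _); apply/andP/eqP => [[ltAk /eqP<-]|->].
  by rewrite inordK.
by rewrite inord_val ltn_ord.
Qed.

Lemma sum_card_proper (B : {set E}) (f : nat -> K) :
  \sum_(A : {set E} | A \proper B) f #|A| = \sum_(j < #|B|) ('C(#|B|, j))%:R * f j.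
Proof.
rewrite -sum_card_lt; apply: eq_bigl => A; rewrite properEcard.
by have [sAB|] := boolP (A \subset B).
Qed.

Lemma sum_card_subset (B : {set E}) (f : nat -> K) :
  \sum_(A : {set E} | A \subset B) f #|A| = \sum_(j < #|B|.+1) ('C(#|B|, j))%:R * f j.
Proof.
rewrite -sum_card_lt; apply: eq_bigl => A; rewrite ltnS.
by have [/subset_leq_card->|] := boolP (A \subset B).
Qed.

End SubsetSums.

Lemma sum_flats (E : finType) (M : matroid E) (K : nmodType)
    (P : pred {set E}) (F : {set E} -> K) :
  \sum_(w : flats M | P w) F w = \sum_(A : {set E} | is_flat M A && P A) F A.
Proof.
rewrite [RHS](reindex_omap (fun w : flats M => flat_set w) insub) /=.
  apply: eq_bigl => w; rewrite (flatP w) /=; case: insubP => [u _ uw|].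
    by rewrite (val_inj uw) eqxx andbT.
  by rewrite (flatP w).
by move=> A /andP[fA _]; rewrite insubT.
Qed.

(** * Boolean lattices and truncated binomial sums *)

Section Boolean.
Variables (R : rcfType) (z : R[i]).
Local Notation one := (fun=> 1%N : nat).
Local Notation p := (diag z one).
Local Notation V := (tri z one).

Lemma weights_bin n j : weights one n 0 j = 'C(n, j).
Proof.
elim: n j => [|n IHn] [|j]; first by [].
- by rewrite bin_small ?weights_small.
- by rewrite weights_eq1 ?bin0.
- by rewrite weightsSS /= mul1n !IHn binS addnC.
Qed.

Lemma boolean_tri n : V n 0 = \sum_(j < n.+1) ('C(n, j))%:R * p j.
Proof. by rewrite tri_sum; apply: eq_bigr => j _; rewrite weights_bin. Qed.

(** This is the recursion that [chain_gf_eval] asks for, in the lattice of subsets. *)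
Lemma boolean_rec (E : finType) (B : {set E}) : B != set0 ->
  p #|B| = z * \sum_(A : {set E} | A \proper B) p #|A|.
Proof.
rewrite -card_gt0 sum_card_proper; case: #|B| => // n _; rewrite diag_rec.
by congr (_ * _); apply: eq_bigr => j _; rewrite weights_bin.
Qed.

Lemma tri_sub n k : (k <= n)%N ->
  V n k = \sum_(j < n.+1) (weights one (n - k) k j)%:R * p j.
Proof. by move=> lekn; rewrite -{1}(subnK lekn) tri_weights subnK. Qed.

(** Row [m] of Pascal's triangle, cut at [n], is a combination with natural coefficients of the
    expansions of the entries V(n)_k; [c 0 = 1] keeps it nontrivial. *)
Lemma truncated_bin m n : (n <= m)%N -> exists2 c : nat -> nat, c 0%N = 1%N &
  forall j, (j <= n)%N -> 'C(m, j) = (\sum_(k < n.+1) c k * weights one (n - k) k j)%N.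
Proof.
elim: n m => [|n IHn] [|m] //.
- by move=> _; exists one => // -[|j] // _; rewrite big_ord1.
- by move=> _; exists one => // -[|j] // _; rewrite big_ord1.
(* The new coefficient supplies the term of Pascal's rule at [j = n.+1], the one that the truncated
   induction hypothesis does not reach. *)
move=> /IHn[c c0 cE]; exists (fun k => if (k <= n)%N then c k else 'C(m, n.+1)).
  by [].
move=> j lejn; rewrite big_ord_recr /= ltnn subnn.
under eq_bigr => k _ do rewrite -ltnS ltn_ord subSn ?leq_ord //.
case: j lejn => [|j] lejn.
  rewrite bin0 muln0 addn0; transitivity 'C(m, 0); first by rewrite bin0.
  rewrite cE //; apply: eq_bigr => k _.
  by rewrite weightsS0 /= mul1n.
under eq_bigr => k _ do rewrite weightsSS /= mul1n mulnDr.
rewrite big_split /= -cE // binS addnC -addnA; congr addn.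
move: lejn; rewrite ltnS leq_eqVlt => /predU1P[->|ltjn].
  rewrite weights0 eqxx muln1 big1 ?add0n // => k _.
  by rewrite weights_small ?muln0 // subnK ?leq_ord.
by rewrite -cE // weights0 eqSS gtn_eqF // muln0 addn0.
Qed.

Hypothesis z_up : 0 < complex.Im z.

Lemma truncated_neq0 m n : (n <= m)%N -> \sum_(j < n.+1) ('C(m, j))%:R * p j != 0.
Proof.
move=> /truncated_bin[c c0 cE].
have -> : \sum_(j < n.+1) ('C(m, j))%:R * p j =
    \sum_(0 <= k < n.+1) ((c k)%:R : R)%:C%C * V n k.
  rewrite big_mkord; under eq_bigr => j _ do rewrite cE ?leq_ord // natr_sum mulr_suml.
  rewrite exchange_big /=; apply: eq_bigr => k _.
  rewrite tri_sub ?leq_ord // big_distrr /=; apply: eq_bigr => j _.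
  by rewrite natrM rmorph_nat mulrA.
by apply: (tri_comb_neq0 z_up) => // ; rewrite ?c0 ?ltr01 // => k; rewrite ler0n.
Qed.

End Boolean.

Section UniformFlats.
Variables (n m : nat) (le_nm : (n <= m)%N).
Local Notation U := (uniform_matroid le_nm).

Lemma rank_uniform (A : {set 'I_m}) : rank U A = minn #|A| n.
Proof.
apply/eqP; rewrite eqn_leq; apply/andP; split.
  apply/bigmax_leqP => B; rewrite inE => /eqP Bn.
  by rewrite leq_min subset_leq_card ?subsetIl // -Bn subset_leq_card ?subsetIr.
(* A small [A] is enlarged to a basis by points of its complement; a large one already contains a
   basis. *)
have [B Bn sAB] : exists2 B : {set 'I_m}, #|B| == n & (minn #|A| n <= #|A :&: B|)%N.
  have [leAn|/ltnW lenA] := leqP #|A| n.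
    have : (0 < #|[set C : {set 'I_m} | C \subset ~: A & #|C| == n - #|A|]|)%N.
      by rewrite cards_draws bin_gt0 -[#|~: A|](addKn #|A|) cardsC card_ord leq_sub2r.
    rewrite card_gt0 => /set0Pn[C]; rewrite inE => /andP[CA /eqP Cn].
    exists (A :|: C); last by rewrite (setIidPl _) ?subsetUl.
    by rewrite cardsU disjoint_setI0 ?disjoints_subset 1?setCS ?cards0 ?subn0 ?Cn ?subnKC //
      -disjoints_subset disjoint_sym disjoints_subset.
  have : (0 < #|[set C : {set 'I_m} | C \subset A & #|C| == n]|)%N.
    by rewrite cards_draws bin_gt0.
  rewrite card_gt0 => /set0Pn[C]; rewrite inE => /andP[CA Cn].
  by exists C; rewrite // (setIidPr CA) (eqP Cn).
apply: leq_trans sAB _; apply: (leq_bigmax_cond (F := fun B => #|A :&: B|)).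
by rewrite inE.
Qed.

Lemma flat_uniform (A : {set 'I_m}) : is_flat U A = (#|A| < n)%N || (A == setT).
Proof.
apply/forallP/orP => [flatA|[ltAn|/eqP-> x]]; last by rewrite inE.
  have [|/set0Pn[x]] := eqVneq (~: A) set0.
    by move=> A0; right; rewrite -[A]setCK A0 setC0.
  rewrite inE => xA; left; have := flatA x.
  by rewrite xA /= !rank_uniform cardsU1 xA add1n; move: #|A| => a; rewrite /minn;
    do 2!case: ifP; lia.
move=> x; apply/implyP => xA; rewrite !rank_uniform cardsU1 xA add1n; move: #|A| ltAn => a; rewrite /minn;
    do 2!case: ifP; lia.
Qed.

Hypothesis n_gt0 : (0 < n)%N.

Lemma real_rooted_uniform_flats (R : realType) : real_rooted R (chain_poly (flats U)).
Proof.
apply: (real_rooted_gf (lt := fun x y => (x < y)%O)) => [x y|z z_up].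
  exact: comparable_lt.
have flat0 : is_flat U set0 by rewrite flat_uniform cards0 n_gt0.
pose p := diag z (fun=> 1%N); pose T := \sum_(j < n) ('C(m, j))%:R * p j.
(* Every subset of a proper flat is a flat, so [pt] is the Boolean value there; at the ground set
   the recursion forces [z * T]. The values then add up to [(1 + z) * T]. *)
pose pt (A : {set 'I_m}) : R[i] := if (#|A| < n)%N then p #|A| else z * T.
have ltE (w y : flats U) : (w < y)%O = (flat_set w \proper flat_set y).
  by rewrite lt_neqAle properEneq.
have TE : \sum_(A : {set 'I_m} | (#|A| < n)%N) pt A = T.
  transitivity (\sum_(A : {set 'I_m} | (A \subset setT) && (#|A| < n)%N) p #|A|).
    by apply: eq_big => [A|A /= An]; rewrite ?subsetT // /pt An.
  by rewrite sum_card_lt cardsT card_ord.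
have lt0 (y : flats U) : y != Flat flat0 -> (Flat flat0 < y)%O.
  move=> y0; rewrite ltE /= proper0; apply: contraNneq y0 => y0.
  exact/eqP/val_inj.
rewrite (chain_gf_eval ltxx lt_trans lt0 (pt := fun y : flats U => pt y)).
- rewrite (@sum_flats _ U _ xpredT pt) (bigD1 setT) /=; last first.
    by rewrite flat_uniform eqxx orbT.
  have -> : \sum_(A | is_flat U A && true && (A != setT)) pt A = T.
    rewrite -TE; apply: eq_bigl => A; rewrite flat_uniform andbT.
    have [->|] := eqVneq A setT; last by rewrite orbF andbT.
    by rewrite cardsT card_ord ltnNge le_nm.
  rewrite /pt cardsT card_ord ltnNge le_nm /=; have -> : z * T + T = (1 + z) * T by ring.
  rewrite !mulf_neq0 ?addz1_neq0 // /T.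
  by case: (n) n_gt0 le_nm => // k _ lekm; apply: truncated_neq0 => //; exact: ltnW.
- by rewrite /pt /= cards0 n_gt0.
- move=> y y0; under [in RHS]eq_bigl => w do rewrite ltE.
  rewrite (@sum_flats _ U _ (fun A => A \proper flat_set y) pt).
  have yn0 : flat_set y != set0.
    by apply: contraNneq y0 => y0; exact/eqP/val_inj.
  have := flatP y; rewrite flat_uniform /pt; case: ltnP => [ltyn _|leny /= /eqP yT].
    rewrite /p (boolean_rec z yn0); congr (_ * _); apply: eq_big => [A|A /proper_card ltA].
      rewrite flat_uniform; case: (boolP (A \proper y)) => [/proper_card ltA|].
        by rewrite (ltn_trans ltA ltyn).
      by rewrite andbF.
    by rewrite (ltn_trans ltA ltyn).
  congr (_ * _); rewrite -[LHS]TE /pt; apply: eq_bigl => A.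
  rewrite flat_uniform yT properT.
  have [->|] := eqVneq A setT; last by rewrite orbF andbT.
  by rewrite cardsT card_ord andbF ltnNge le_nm.
Qed.

End UniformFlats.

(** * Near-pencils *)

Section ColoopFlats.
Variables (E : finType) (M : matroid E) (k : nat).
Implicit Types (D : {set E + 'I_k}) (A : {set E}) (S : {set 'I_k}).

Definition lpart D : {set E} := [set x | inl x \in D].
Definition rpart D : {set 'I_k} := [set i | inr i \in D].
Definition join_parts (AS : {set E} * {set 'I_k}) : {set E + 'I_k} :=
  [set u | match u with inl x => x \in AS.1 | inr i => i \in AS.2 end].

Lemma lpart_join AS : lpart (join_parts AS) = AS.1.
Proof. by apply/setP => x; rewrite !inE. Qed.

Lemma rpart_join AS : rpart (join_parts AS) = AS.2.
Proof. by apply/setP => i; rewrite !inE. Qed.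

Lemma lpart0 : lpart set0 = set0. Proof. by apply/setP => x; rewrite !inE. Qed.
Lemma rpart0 : rpart set0 = set0. Proof. by apply/setP => x; rewrite !inE. Qed.
Lemma lpartT : lpart setT = setT. Proof. by apply/setP => x; rewrite !inE. Qed.

Lemma join_partsK : cancel join_parts (fun D => (lpart D, rpart D)).
Proof. by case=> A S; rewrite lpart_join rpart_join. Qed.

Lemma partsK : cancel (fun D => (lpart D, rpart D)) join_parts.
Proof. by move=> D; apply/setP => -[x|i]; rewrite !inE. Qed.

Lemma card_parts D : #|D| = (#|lpart D| + #|rpart D|)%N.
Proof.
rewrite -!sum1_card big_sumType /=.
by congr addn; apply: eq_bigl => x; rewrite inE.
Qed.

Lemma subset_parts D1 D2 :
  (D1 \subset D2) = (lpart D1 \subset lpart D2) && (rpart D1 \subset rpart D2).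
Proof.
apply/subsetP/andP => [sD|[/subsetP sA /subsetP sS] [x|i]].
- by split; apply/subsetP => x; rewrite !inE; exact: sD.
- by have := sA x; rewrite !inE.
- by have := sS i; rewrite !inE.
Qed.

(** Every basis contains all the coloops, so those in [D] are counted in full. *)
Lemma rank_coloops D : rank (add_coloops M k) D = (rank M (lpart D) + #|rpart D|)%N.
Proof.
have cap A : #|D :&: coloop_ext k A| = (#|lpart D :&: A| + #|rpart D|)%N.
  rewrite card_parts.
  have -> : lpart (D :&: coloop_ext k A) = lpart D :&: A.
    by apply/setP => x; rewrite !inE.
  suff -> : rpart (D :&: coloop_ext k A) = rpart D by [].
  by apply/setP => i; rewrite !inE andbT.
apply/eqP; rewrite eqn_leq; apply/andP; split.
  apply/bigmax_leqP => B /imsetP[A MA ->]; rewrite cap leq_add2r.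
  exact: (leq_bigmax_cond (F := fun A => #|lpart D :&: A|)).
have [A MA ->] : {A | A \in bases M & rank M (lpart D) = #|lpart D :&: A|}.
  by apply: (eq_bigmax_cond (fun A => #|lpart D :&: A|)); rewrite card_gt0 bases_neq0.
rewrite -cap; apply: (leq_bigmax_cond (F := fun B => #|D :&: B|)).
exact: imset_f.
Qed.

(** Adding a missing coloop always raises the rank, so the part in [E] decides. *)
Lemma flat_coloops D : is_flat (add_coloops M k) D = is_flat M (lpart D).
Proof.
have lpartl x : lpart (inl x |: D) = x |: lpart D.
  by apply/setP => y; rewrite !inE.
have rpartl x : rpart (inl x |: D) = rpart D.
  by apply/setP => y; rewrite !inE.
apply/forallP/forallP => flatD; first move=> x.
  have := flatD (inl x); rewrite !rank_coloops lpartl rpartl ltn_add2r.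
  by rewrite inE.
move=> [x|i]; rewrite !rank_coloops; apply/implyP => uD.
  rewrite lpartl rpartl ltn_add2r; have := flatD x.
  by rewrite inE uD.
have -> : lpart (inr i |: D) = lpart D by apply/setP => y; rewrite !inE.
have -> : rpart (inr i |: D) = i |: rpart D by apply/setP => y; rewrite !inE.
by rewrite cardsU1 inE uD ltn_add2l.
Qed.

Lemma sum_parts (K : nmodType) (P : pred {set E}) (Q : pred {set 'I_k})
    (F : {set E} -> {set 'I_k} -> K) :
  \sum_(D | P (lpart D) && Q (rpart D)) F (lpart D) (rpart D) =
  \sum_(A | P A) \sum_(S | Q S) F A S.
Proof.
rewrite pair_big /= (reindex join_parts); last first.
  by exists (fun D => (lpart D, rpart D)) => x _; [exact: join_partsK | exact: partsK].
by apply: eq_big => AS; rewrite ?lpart_join ?rpart_join.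
Qed.

End ColoopFlats.

Section NearPencil.
Variables (n m : nat).
Variables (R : rcfType) (z : R[i]).
Local Notation p := (diag z (fun=> 1%N)).
Local Notation V := (tri z (fun=> 1%N)).
Local Notation s := (m - n + 2)%N.
Local Notation k := (n - 2)%N.
Local Notation NP := (near_pencil n m).

(** Half of [m - n], so that the line has [2 * c + 2] points. It becomes the nonnegative coefficient
    of the second row entry in the total. *)
Let c : R[i] := ((m - n)%:R / 2 : R)%:C%C.

Lemma card_line : s%:R = 2 * c + 2.
Proof.
have -> : 2 * c = (m - n)%:R.
  have <- : (2 : R)%:C%C = 2 by rewrite rmorph_nat.
  by rewrite /c -rmorphM mulrC divfK ?pnatr_eq0 // rmorph_nat.
by rewrite natrD.
Qed.

(* The value attached to a flat formed by the whole line and [j] coloops. *)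
Definition pencil j : R[i] := (1 + c) * p j.+2 - c * p j.+1.

Lemma sum_pascal N (f : nat -> R[i]) :
  \sum_(j < N.+1) ('C(N, j))%:R * (f j + f j.+1) =
  \sum_(j < N.+2) ('C(N.+1, j))%:R * f j.
Proof.
under eq_bigr => j _ do rewrite mulrDr.
rewrite big_split /= [RHS]big_ord_recl /= bin0.
under [in RHS]eq_bigr => j _ do rewrite -[bump 0 j]/(j.+1) binS natrD mulrDl.
rewrite big_split /= addrA; congr (_ + _).
rewrite [LHS]big_ord_recl [in RHS]big_ord_recr /= bin0 bin_small // mul0r addr0.
by [].
Qed.

(** The bracket collects the flats with [j] given coloops: no point of the line, one of its [s]
    points, or the whole line. *)
Lemma pencil_sum N :
  \sum_(j < N.+1) ('C(N, j))%:R * (p j + s%:R * p j.+1 + pencil j) =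
  V N.+2 0 + c * V N.+2 1.
Proof.
have -> : V N.+2 1 = V N.+2 0 - V N.+1 0.
  by rewrite [V N.+2 0]tri_step // mul1r addrK.
(* As [s] is [2 * c + 2], each bracket is a sum of two consecutive values of [g], and Pascal's rule
   applies twice. *)
pose g j := p j + (1 + c) * p j.+1.
transitivity (\sum_(j < N.+1) ('C(N, j))%:R * (g j + g j.+1)).
  by apply: eq_bigr => j _; rewrite card_line /pencil /g; congr (_ * _); ring.
rewrite sum_pascal (boolean_tri z N.+2) -(sum_pascal N.+1 p) boolean_tri.
rewrite mulrBr !big_distrr -sumrB -big_split /=.
by apply: eq_bigr => j _; rewrite /g; ring.
Qed.

(** By [pencil_sum], the right-hand side is [z] times the sum over all flats inside the line with
    [N] coloops, that flat included: this is the recursion with [z * pencil N] added to both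
    sides. *)
Lemma pencil_wrap N : (1 + z) * pencil N = z * (V N.+2 0 + c * V N.+2 1).
Proof.
have -> : V N.+2 1 = V N.+2 0 - V N.+1 0.
  by rewrite [V N.+2 0]tri_step // mul1r addrK.
transitivity ((1 + c) * (z * V N.+2 0) - c * (z * V N.+1 0)); last by ring.
by rewrite !tri_wrap /pencil /diag; ring.
Qed.

(** With at most one point of the line, every subset of the flat is a flat, whence the Boolean
    value. *)
Definition np_value (A : {set 'I_s}) (S : {set 'I_k}) : R[i] :=
  if (#|A| < 2)%N then p (#|A| + #|S|) else pencil #|S|.

Lemma flat_line (A : {set 'I_s}) :
  is_flat (uniform_matroid (leq_addl (m - n) 2)) A = (#|A| < 2)%N || (A == setT).
Proof. exact: flat_uniform. Qed.

Lemma np_sum (S : {set 'I_k}) :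
  \sum_(A : {set 'I_s} | (#|A| < 2)%N || (A == setT))
    \sum_(S' : {set 'I_k} | S' \subset S) np_value A S' =
  V #|S|.+2 0 + c * V #|S|.+2 1.
Proof.
rewrite -pencil_sum (bigD1 setT) ?eqxx ?orbT //=.
have cT : (#|[set: 'I_s]| < 2)%N = false by rewrite cardsT card_ord; lia.
rewrite /np_value cT (sum_card_subset S pencil).
have -> : \sum_(A : {set 'I_s} | ((#|A| < 2)%N || (A == setT)) && (A != setT))
    \sum_(S' : {set 'I_k} | S' \subset S)
       (if (#|A| < 2)%N then p (#|A| + #|S'|) else pencil #|S'|) =
  \sum_(A : {set 'I_s} | (A \subset setT) && (#|A| < 2)%N)
    \sum_(j < #|S|.+1) ('C(#|S|, j))%:R * p (#|A| + j).
  apply: eq_big => [A|A /andP[/orP[ltA|->//] _]].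
    by rewrite subsetT; have [->|] := eqVneq A setT; rewrite ?cT ?orbF ?andbT.
  by rewrite ltA; exact: (sum_card_subset S (fun j => p (#|A| + j))).
rewrite (sum_card_lt _ (fun a => \sum_(j < #|S|.+1) ('C(#|S|, j))%:R * p (a + j))).
rewrite [X in _ + X = _]big_ord_recl [X in _ + (_ + X) = _]big_ord1 /= cardsT card_ord.
rewrite bin0 bin1 mul1r.
rewrite big_distrr -!big_split /=; apply: eq_bigr => j _.
by rewrite -[(bump 0 0 + j)%N]/(j.+1) add0n; ring.
Qed.

Hypothesis z_up : 0 < complex.Im z.

Lemma chain_gf_near_pencil_neq0 :
  chain_gf (fun x y : flats NP => (x < y)%O) z [set: flats NP] != 0.
Proof.
have flatE D : is_flat NP D = (#|lpart D| < 2)%N || (lpart D == setT).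
  by rewrite flat_coloops flat_line.
have flat0 : is_flat NP set0.
  by rewrite flatE lpart0 cards0.
pose pt (D : {set 'I_s + 'I_k}) := np_value (lpart D) (rpart D).
have ltE (w y : flats NP) : (w < y)%O = (flat_set w \proper flat_set y).
  by rewrite lt_neqAle properEneq.
have lt0 (y : flats NP) : y != Flat flat0 -> (Flat flat0 < y)%O.
  move=> y0; rewrite ltE /= proper0; apply: contraNneq y0 => y0.
  exact/eqP/val_inj.
have sumE D : lpart D = setT ->
    \sum_(B | is_flat NP B && (B \subset D)) pt B =
      V #|rpart D|.+2 0 + c * V #|rpart D|.+2 1.
  move=> DT; rewrite -np_sum -sum_parts; apply: eq_bigl => B.
  by rewrite flatE subset_parts DT subsetT.
rewrite (chain_gf_eval ltxx lt_trans lt0 (pt := fun y : flats NP => pt y)).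
- rewrite (@sum_flats _ NP _ xpredT pt) mulf_neq0 ?addz1_neq0 //.
  have -> : \sum_(A | is_flat NP A && true) pt A =
      \sum_(B | is_flat NP B && (B \subset setT)) pt B.
    by apply: eq_bigl => B; rewrite subsetT.
  rewrite sumE ?lpartT //.
  (* The coefficients of the entries 0 and 1 are 1 and [c]; both entries exist because [N] is at
     least 2. *)
  pose a i : R := if i == 0%N then 1 else if i == 1%N then (m - n)%:R / 2 else 0.
  set N := #|rpart setT|.+2.
  have a0 i : 0 <= a i.
    rewrite /a; case: ifP => // _; case: ifP => // _.
    by rewrite mulr_ge0 ?invr_ge0 ?ler0n.
  have := @tri_comb_neq0 R z z_up (fun=> 1%N) (fun=> isT) N a a0 ltr01.
  rewrite big_mkord 2!big_ord_recl /= big1 ?addr0 ?mul1r // => i _.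
  by rewrite /a /= mul0r.
- by rewrite /pt /np_value lpart0 rpart0 !cards0.
- move=> y y0; under [in RHS]eq_bigl => w do rewrite ltE.
  rewrite (@sum_flats _ NP _ (fun A => A \proper flat_set y) pt).
  have yn0 : flat_set y != set0.
    by apply: contraNneq y0 => y0; exact/eqP/val_inj.
  have := flatP y; rewrite flatE; case: ltnP => [lty _|ley /= /eqP yT].
    have ltB (B : {set 'I_s + 'I_k}) : B \subset flat_set y -> (#|lpart B| < 2)%N.
      by rewrite subset_parts => /andP[/subset_leq_card/leq_ltn_trans->].
    rewrite /pt /np_value lty -card_parts (boolean_rec z yn0); congr (_ * _).
    apply: eq_big => [B|B /proper_sub/ltB ltB2]; last by rewrite ltB2 card_parts.
    rewrite flatE; case: (boolP (B \proper y)) => [/proper_sub/ltB->//|].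
    by rewrite andbF.
  have ptE : pt y = pencil #|rpart y| by rewrite /pt /np_value ltnNge ley.
  have fy : is_flat NP y && (flat_set y \subset flat_set y) by rewrite (flatP y) subxx.
  have := sumE y yT; rewrite (bigD1 (flat_set y)) //= ptE => yE.
  (* Removing the flat [y] itself from the sum in [pencil_wrap] leaves the recursion over its proper
     subflats. *)
  have := pencil_wrap #|rpart y|; rewrite -yE; move: (pencil _) => u.
  rewrite mulrDl mul1r mulrDr addrC => /addrI->; congr (_ * _); apply: eq_bigl => B.
  by rewrite properEneq -andbA [(_ != _) && _]andbC.
Qed.

End NearPencil.

Lemma real_rooted_near_pencil (R : realType) n m :
  real_rooted R (chain_poly (flats (near_pencil n m))).
Proof.
apply: (real_rooted_gf (lt := fun x y => (x < y)%O)) => [x y|z z_up].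
  exact: comparable_lt.
exact: chain_gf_near_pencil_neq0.
Qed.

Theorem theorem1p3 (R : realType) :
  [/\ (forall n p e : nat, (0 < n)%N -> prime p -> (0 < e)%N ->
        forall (F : finFieldType) (V : vectType F),
          #|F| = (p ^ e)%N -> \dim (fullv : {vspace V}) = n ->
          real_rooted R (chain_poly (subspaces V))),
      (forall n : nat, (0 < n)%N -> real_rooted R (chain_poly (Pi n))),
      (forall n : nat, (0 < n)%N -> real_rooted R (chain_poly (PiB n))),
      (forall n m : nat, (2 <= n)%N -> (n <= m)%N ->
        real_rooted R (chain_poly (flats (near_pencil n m))))
    & (forall (n m : nat) (le_nm : (n <= m)%N), (0 < n)%N ->
        real_rooted R (chain_poly (flats (uniform_matroid le_nm))))].
Proof.
split.
- by move=> n p e _ _ _ F V _ _; exact: real_rooted_subspaces.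
- by move=> n n_gt0; exact: real_rooted_Pi.
- by move=> n _; exact: real_rooted_PiB.
- by move=> n m _ _; exact: real_rooted_near_pencil.
- by move=> n m le_nm n_gt0; exact: real_rooted_uniform_flats.
Qed.
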